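(* Let $A$ be an affine cellular $k$-algebra with cell chain $0=J_0\subset J_1\subset\cdots\subset J_n=A$ and cell data $(B_i,\sigma_i,\Delta_i,\psi^{(i)},\alpha_i)$ such that for every $1\le i\le n$ the determinant $\det(\psi^{(i)})$ is not a zero-divisor in $B_i$ and $J_i/J_{i-1}$ is an idempotent ideal of $A/J_{i-1}$. If $A$ is a finite type algebra over an affine $\mathbb C$-algebra, then the embedding $\Theta:A\to\widehat A$ of $A$ into its asymptotic algebra induces an isomorphism of periodic cyclic homology $HP_*(A)\cong HP_*(\widehat A)$.
   Context: Conventions. $k$ is a commutative Noetherian domain. A $k$-involution is a $k$-linear anti-automorphism whose square is the identity. An affine commutative $k$-algebra is a finitely generated commutative unital $k$-algebra. The element $0$ counts as a zero-divisor. An ideal $J$ is idempotent if $J^2=J$. $A$ is a finite type algebra over an affine (finitely generated commutative unital) $\mathbb C$-algebra $K$ if $A$ is a $K$-algebra (with $K$ acting centrally) that is finitely generated as a $K$-module. Periodic cyclic homology is taken over $\mathbb C$. Affine cell ideal. Let $A$ be a unital $k$-algebra with a $k$-involution $i$. A two-sided ideal $J$ with $i(J)=J$ is an affine cell ideal if (1) there are a free $k$-module $V$ of finite rank $d\ge1$ and a nonzero affine commutative $k$-algebra $B$ with $k$-involution $\sigma$ such that $\Delta:=V\otimes_kB$ is an $A$-$B$-bimodule whose right $B$-structure is induced by the regular module $B_B$; (2) there is an $A$-$A$-bimodule isomorphism $\alpha:J\to\Delta\otimes_B\Delta'$, where $\Delta'=B\otimes_kV$ is a $B$-$A$-bimodule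 with left $B$-structure induced by ${}_BB$ and right $A$-structure $(b\otimes v)a:=\tau(i(a)(v\otimes b))$, $\tau$ the flip, such that, identifying $\Delta\otimes_B\Delta'$ with $V\otimes_kB\otimes_kV$, $\alpha(i(\alpha^{-1}(u\otimes b\otimes v)))=v\otimes\sigma(b)\otimes u$. $\Delta$ is the cell module of $J$. There is a $k$-bilinear $\psi:V\times V\to B$ with $\alpha(\alpha^{-1}(u\otimes b\otimes v)\,\alpha^{-1}(u'\otimes b'\otimes v'))=u\otimes b\psi(v,u')b'\otimes v'$. Fix a basis $v_1,\dots,v_d$ of $V$; the swich matrix is $\psi=(\psi(v_r,v_s))_{r,s}\in M_d(B)$. Identifying $v_r\otimes b\otimes v_s$ with $bE_{rs}$, $\alpha$ becomes a bijection $J\to M_d(B)$ with $\alpha(xy)=\alpha(x)\psi\alpha(y)$. $(B,\sigma,\Delta,\psi,\alpha)$ is the cell datum of $J$. Affine cellular algebra. $A$ (with $i$) is affine cellular if $A=J_1'\oplus\cdots\oplus J_n'$ as $k$-modules with $i(J_j')=J_j'$, such that the $J_j=\bigoplus_{l\le j}J_l'$ form a chain of two-sided ideals $0=J_0\subset J_1\subset\cdots\subset J_n=A$ (cell chain) and each $J_j/J_{j-1}$ is an affine cell ideal of $A/J_{j-1}$ (for the induced involution), with cell datum $(B_j,\sigma_j,\Delta_j,\psi^{(j)},\alpha_j)$; $d_j=\mathrm{rank}_{B_j}(\Delta_j)$. The asymptotic algebra is the ring $\widehat A=M_{d_n}(B_n)\times\cdots\times M_{d_1}(B_1)$ with ordinary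 matrix multiplication. If no $\det(\psi^{(j)})$ is a zero-divisor, $\Theta:A\to\widehat A$, $\Theta(a)=(\alpha_n(ae_n),\ldots,\alpha_1(ae_1))$ with $e_j=\alpha_j^{-1}(\mathbf I_{d_j})\in J_j/J_{j-1}$, is an injective ring homomorphism. *)

(* Defs.v *)
From HB Require Import structures.
From mathcomp Require Import all_boot all_order all_algebra.
From mathcomp Require Import generic_quotient ring_quotient.
From mathcomp Require Import boolp classical_sets.
From mathcomp Require Import finmap zify.
From mathcomp.multinomials Require Import monalg.

Set Implicit Arguments.
Unset Strict Implicit.
Unset Printing Implicit Defensive.

Import GRing.Theory.

Local Open Scope classical_set_scope.
Local Open Scope ring_scope.
Local Open Scope quotient_scope.

Record submodule (R : pzRingType) (V : lmodType R) := Submodule {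
  submod_set :> V -> Prop;
  submod0 : submod_set 0;
  submodP : forall c x y, submod_set x -> submod_set y -> submod_set (c *: x + y)
}.

Section QuotientModule.
Variables (R : pzRingType) (V : lmodType R) (S : submodule V).

Definition submod_mem : pred V := fun x => `[< S x >].

Fact submod_mem_closed : GRing.submod_closed submod_mem.
Proof.
split; first by apply/asboolP; exact: submod0.
by move=> c x y /asboolP Sx /asboolP Sy; apply/asboolP; exact: submodP.
Qed.

HB.instance Definition _ := GRing.isZmodClosed.Build V submod_mem
  (GRing.submod_closedB submod_mem_closed).

Definition submod_pred := GRing.ZmodClosed.clone V submod_mem _.
Definition lquot := @Quotient.quot V submod_pred.

HB.instance Definition _ := GRing.Zmodule.on lquot.
HB.instance Definition _ : EqQuotient V (Quotient.equiv submod_pred) lquot :=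
  EqQuotient.on lquot.

Definition lpi (x : V) : lquot := \pi_lquot x.

Lemma lpiE x y : (lpi x = lpi y) <-> S (x - y).
Proof.
split=> [/eqP|Sxy]; rewrite /lpi.
  by rewrite -Quotient.idealrBE => /asboolP.
by apply/eqP; rewrite -Quotient.idealrBE; apply/asboolP.
Qed.

Lemma lpi_repr (q : lquot) : lpi (repr q) = q.
Proof. by rewrite /lpi reprK. Qed.

Lemma lpi_surj (q : lquot) : exists x, q = lpi x.
Proof. by exists (repr q); rewrite lpi_repr. Qed.

Fact lpiB : {morph lpi : x y / x - y}.
Proof. by move=> x y; rewrite /lpi raddfB. Qed.

HB.instance Definition _ := GRing.isZmodMorphism.Build V lquot lpi lpiB.

Definition lquot_scale (c : R) (q : lquot) : lquot := lpi (c *: repr q).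

Lemma lpiZ c x : lpi (c *: x) = lquot_scale c (lpi x).
Proof.
apply/lpiE; rewrite -scalerBr -[_ *: _]addr0; apply: submodP (submod0 S).
by apply/lpiE; rewrite lpi_repr.
Qed.

Fact lquot_scaleA a b q :
  lquot_scale a (lquot_scale b q) = lquot_scale (a * b) q.
Proof. by case: (lpi_surj q) => x ->; rewrite -!lpiZ scalerA. Qed.

Fact lquot_scale1 : left_id 1 lquot_scale.
Proof. by move=> q; case: (lpi_surj q) => x ->; rewrite -!lpiZ scale1r. Qed.

Fact lquot_scaleDr : right_distributive lquot_scale +%R.
Proof.
move=> a q r; case: (lpi_surj q) => x ->; case: (lpi_surj r) => y ->.
by rewrite -raddfD -!lpiZ scalerDr raddfD.
Qed.

Fact lquot_scaleDl q : {morph lquot_scale^~ q : a b / a + b}.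
Proof.
by move=> a b; case: (lpi_surj q) => x ->; rewrite -!lpiZ scalerDl raddfD.
Qed.

HB.instance Definition _ := GRing.Zmodule_isLmodule.Build R lquot
  lquot_scaleA lquot_scale1 lquot_scaleDr lquot_scaleDl.

HB.instance Definition _ := GRing.isScalable.Build R V lquot *:%R lpi lpiZ.

(* The map induced by f on V / S; meaningful when f vanishes on S *)
Definition lquot_lift (W : lmodType R) (f : V -> W) (q : lquot) : W := f (repr q).

Lemma lquot_lift_pi (W : lmodType R) (f : {linear V -> W}) x :
  (forall y, S y -> f y = 0) -> lquot_lift f (lpi x) = f x.
Proof.
move=> fS; apply/eqP; rewrite /lquot_lift -subr_eq0 -linearB fS //.
by apply/lpiE; rewrite lpi_repr.
Qed.

Lemma lquot_lift_linear (W : lmodType R) (f : {linear V -> W}) :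
  (forall y, S y -> f y = 0) -> linear (lquot_lift f).
Proof.
move=> fS c q r; case: (lpi_surj q) => x ->; case: (lpi_surj r) => y ->.
by rewrite -linearP !lquot_lift_pi // linearP.
Qed.

End QuotientModule.

Section Homology.
Variables (R : pzRingType) (U V W : lmodType R).
Variables (d : {linear U -> V}) (e : {linear V -> W}).

Definition cycle_pred : pred V := fun v => e v == 0.

Fact cycle_pred_closed : GRing.subsemimod_closed cycle_pred.
Proof.
apply: GRing.submod_closed_semi; split; first by rewrite unfold_in linear0.
move=> c x y; rewrite !unfold_in => /eqP ex /eqP ey.
by rewrite linearP ex ey scaler0 addr0.
Qed.

Record cycles := Cycle { cycle_val : V; _ : cycle_val \in cycle_pred }.

HB.instance Definition _ := [isSub for cycle_val].
HB.instance Definition _ := [Choice of cycles by <:].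
HB.instance Definition _ :=
  GRing.SubChoice_isSubLmodule.Build R V cycle_pred cycles cycle_pred_closed.

Definition boundary_set : set cycles := [set z | exists u : U, d u = cycle_val z].

Fact boundary_set0 : boundary_set 0.
Proof. by exists 0; rewrite linear0 -[RHS]/(val (0 : cycles)) linear0. Qed.

Fact boundary_setP c x y :
  boundary_set x -> boundary_set y -> boundary_set (c *: x + y).
Proof.
move=> [u xu] [v yv]; exists (c *: u + v).
by rewrite linearP xu yv -[RHS]/(val (c *: x + y)) linearP.
Qed.

Definition boundaries := Submodule boundary_set0 boundary_setP.

(* ker e / (im d inside ker e); this is ker e / im d when e \o d = 0 *)
Definition homology : lmodType R := lquot boundaries.

End Homology.

Section HomologyMap.
Variables (R : pzRingType) (U V W U' V' W' : lmodType R).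
Variables (d : {linear U -> V}) (e : {linear V -> W}).
Variables (d' : {linear U' -> V'}) (e' : {linear V' -> W'}).
Variables (fU : U -> U') (fV : {linear V -> V'}) (fW : {linear W -> W'}).
Hypothesis fd : forall u, fV (d u) = d' (fU u).
Hypothesis fe : forall v, fW (e v) = e' (fV v).

Fact homology_map_cycle (z : cycles e) : fV (cycle_val z) \in cycle_pred e'.
Proof. by case: z => v /= /eqP ev; rewrite unfold_in -fe ev linear0. Qed.

Definition cycles_map (z : cycles e) : homology d' e' :=
  lpi (boundaries d' e') (Cycle (homology_map_cycle z)).

Fact cycles_map_linear : linear cycles_map.
Proof.
move=> c x y; rewrite /cycles_map -linearP; congr (lpi _ _); apply: val_inj.
by rewrite /= !linearP.
Qed.

HB.instance Definition _ :=
  GRing.isLinear.Build R (cycles e) (homology d' e') *:%R cycles_map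
    cycles_map_linear.

Definition homology_map : homology d e -> homology d' e' :=
  lquot_lift cycles_map.

Fact cycles_map_boundary z : boundaries d e z -> cycles_map z = 0.
Proof.
move=> [u du]; rewrite -(raddf0 (lpi (boundaries d' e'))).
by apply/lpiE; rewrite subr0; exists (fU u); rewrite /= -fd du.
Qed.

Fact homology_map_linear : linear homology_map.
Proof. exact: lquot_lift_linear cycles_map_boundary. Qed.

End HomologyMap.

Section TensorPower.
Variables (F : fieldType) (M : lmodType F) (n : nat).
Local Notation tuples := {ffun 'I_n -> M}.

Definition upd (a : tuples) (i : 'I_n) (x : M) : tuples :=
  [ffun j => if j == i then x else a j].

Definition multilinear (P : lmodType F) (f : tuples -> P) :=
  forall a i c x y,
    f (upd a i (c *: x + y)) = c *: f (upd a i x) + f (upd a i y).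

Local Notation free := {malg F[tuples]}.

(* tpow is the n-fold tensor power of M over F: the free module on n-tuples
   modulo the submodule generated by the multilinearity relations; tens a is
   the elementary tensor a_0 (x) ... (x) a_{n-1} *)
Definition tens_rel (g : free) : Prop :=
  forall S : submodule free,
    (forall a i c x y, S (<< upd a i (c *: x + y) >>
       - (c *: << upd a i x >> + << upd a i y >>))) ->
    S g.

Fact tens_rel0 : tens_rel 0.
Proof. by move=> S _; exact: submod0. Qed.

Fact tens_relP c g h : tens_rel g -> tens_rel h -> tens_rel (c *: g + h).
Proof. by move=> rg rh S HS; apply: submodP; [exact: rg | exact: rh]. Qed.

Definition tens_rels := Submodule tens_rel0 tens_relP.

Definition tpow : lmodType F := lquot tens_rels.

Definition tens (a : tuples) : tpow := lpi tens_rels << a >>.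

Fact tens_multilinear : multilinear tens.
Proof.
move=> a i c x y; rewrite /tens -linearP; apply/lpiE => S; exact.
Qed.

Section Lift.
Variables (P : lmodType F) (f : tuples -> P).

Definition free_lift (g : free) : P := \sum_(a <- msupp g) g@_a *: f a.

Lemma free_liftEw (D : {fset tuples}) g : (msupp g `<=` D)%fset ->
  free_lift g = \sum_(a <- D) g@_a *: f a.
Proof.
move=> gD; apply: big_fset_incl => // a _.
by rewrite -mcoeff_eq0 => /eqP->; rewrite scale0r.
Qed.

Fact free_lift_linear : linear free_lift.
Proof.
move=> c g h.
pose D := (msupp g `|` msupp h `|` msupp (c *: g + h))%fset.
rewrite !(@free_liftEw D) /D.
- rewrite scaler_sumr -big_split; apply: eq_bigr => a _ /=.
  by rewrite mcoeffD mcoeffZ scalerDl scalerA.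
- by rewrite -fsetUA fsetUCA fsubsetUl.
- by rewrite -fsetUA fsubsetUl.
- by rewrite fsubsetUr.
Qed.

HB.instance Definition _ :=
  GRing.isLinear.Build F free P *:%R free_lift free_lift_linear.

Lemma free_liftU a : free_lift << a >> = f a.
Proof.
rewrite (@free_liftEw [fset a]%fset) ?msuppU_le //.
by rewrite big_seq_fset1 mcoeffUU scale1r.
Qed.

Definition tlift : tpow -> P := lquot_lift free_lift.

Hypothesis fM : multilinear f.

Fact free_lift_rel g : tens_rels g -> free_lift g = 0.
Proof.
have S0 : free_lift 0 = 0 by exact: linear0.
have SP c x y : free_lift x = 0 -> free_lift y = 0 -> free_lift (c *: x + y) = 0.
  by move=> x0 y0; rewrite linearP /= x0 y0 scaler0 addr0.
move/(_ (Submodule S0 SP)); apply => a i c x y /=.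
by rewrite linearB linearP /= !free_liftU fM subrr.
Qed.

Lemma tlift_linear : linear tlift.
Proof. exact: lquot_lift_linear free_lift_rel. Qed.

Lemma tlift_tens a : tlift (tens a) = f a.
Proof. by rewrite /tlift (lquot_lift_pi _ free_lift_rel) /= free_liftU. Qed.

End Lift.

Lemma tpow_ext (P : lmodType F) (g h : {linear tpow -> P}) :
  (forall a, g (tens a) = h (tens a)) -> g =1 h.
Proof.
move=> gh t; have [x ->] := lpi_surj t.
rewrite [x]monalgE !raddf_sum /=; apply: eq_bigr => a _.
have -> : << x@_a *g a >> = x@_a *: << a >> :> free.
  by apply/malgP => b; rewrite mcoeffZ !mcoeffU mulrnAr mulr1.
have -> : lpi tens_rels (x@_a *: << a >>) = x@_a *: tens a by rewrite linearZ.
by rewrite !linearZ_LR gh.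
Qed.

End TensorPower.

Lemma multilinear_sum (F : fieldType) (M P : lmodType F) n (I : finType)
    (s : I -> F) (f : I -> {ffun 'I_n -> M} -> P) :
  (forall k, multilinear (f k)) ->
  multilinear (fun a => \sum_k s k *: f k a).
Proof.
move=> fM a i c x y; rewrite scaler_sumr -big_split; apply: eq_bigr => k _ /=.
by rewrite fM scalerDr !scalerA mulrC.
Qed.

Lemma multilinear_tens (F : fieldType) (M M' : lmodType F) m n
    (g : {ffun 'I_m -> M} -> {ffun 'I_n -> M'}) :
  (forall a i, exists j (phi : M -> M'),
     linear phi /\ forall x, g (upd a i x) = upd (g a) j (phi x)) ->
  multilinear (fun a => tens (g a)).
Proof.
move=> gP a i c x y; have [j [phi [phiL gE]]] := gP a i.
by rewrite !gE phiL tens_multilinear.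
Qed.

Section TupleOperators.
Variables (F : fieldType) (A : algType F).

(* (a_0, ..., a_{q+1}) |-> (a_0, ..., a_i a_{i+1}, ..., a_{q+1}) *)
Definition face q (i : 'I_q.+1) (a : {ffun 'I_q.+2 -> A}) : {ffun 'I_q.+1 -> A} :=
  [ffun j : 'I_q.+1 =>
     if (j < i)%N then a (widen_ord (leqnSn _) j)
     else if (j == i :> nat) then a (widen_ord (leqnSn _) j) * a (lift ord0 j)
     else a (lift ord0 j)].

(* (a_0, ..., a_{q+1}) |-> (a_{q+1} a_0, a_1, ..., a_q) *)
Definition last_face q (a : {ffun 'I_q.+2 -> A}) : {ffun 'I_q.+1 -> A} :=
  [ffun j : 'I_q.+1 =>
     if (j == 0 :> nat) then a ord_max * a ord0 else a (widen_ord (leqnSn _) j)].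

(* (a_0, ..., a_q) |-> (a_q, a_0, ..., a_{q-1}) *)
Definition rot_tuple q (a : {ffun 'I_q.+1 -> A}) : {ffun 'I_q.+1 -> A} :=
  [ffun j => a (ord_pred j)].

Fact face_multilinear q (i : 'I_q.+1) : multilinear (fun a => tens (face i a)).
Proof.
apply: multilinear_tens => a j.
have [ji|ij] := ltnP j i.
  exists (Ordinal (ltn_trans ji (ltn_ord i))), id; split=> // x.
  apply/ffunP => l; rewrite !ffunE -!val_eqE /=.
  have [li|li] := ltnP l i; first by case: eqP.
  have -> : (l == j :> nat) = false by lia.
  have -> : ((1 + l)%N == j :> nat) = false by lia.
  by [].
have [ji|ji] := eqVneq (j : nat) i.
  exists i, (fun x => x * a (lift ord0 i)); split=> [c x y|x].
    by rewrite mulrDl scalerAl.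
  apply/ffunP => l; rewrite !ffunE -!val_eqE /=.
  have [li|li] := ltnP l i.
    by rewrite ji !ifF //; lia.
  have [le|le] := eqVneq (l : nat) i.
    have -> : l = i by apply: val_inj.
    rewrite ji eqxx; have -> : ((1 + i)%N == i :> nat) = false by lia.
    by [].
  by have -> : ((1 + l)%N == j :> nat) = false by lia.
have [ji1|ji1] := eqVneq (j : nat) i.+1.
  exists i, (fun x => a (widen_ord (leqnSn _) i) * x); split=> [c x y|x].
    by rewrite mulrDr scalerAr.
  apply/ffunP => l; rewrite !ffunE -!val_eqE /=.
  have [li|li] := ltnP l i.
    by rewrite ji1 !ifF //; lia.
  have [le|le] := eqVneq (l : nat) i.
    have -> : l = i by apply: val_inj.
    by rewrite ji1 ltn_eqF // eqxx.
  by have -> : ((1 + l)%N == j :> nat) = false by lia.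
have jq : (j.-1 < q.+1)%N by have := ltn_ord j; lia.
exists (Ordinal jq), id; split=> // x.
apply/ffunP => l; rewrite !ffunE -!val_eqE /=.
have [li|li] := ltnP l i; first by rewrite !ifF //; lia.
have [le|le] := eqVneq (l : nat) i.
  have -> : (l == j :> nat) = false by lia.
  have -> : ((1 + l)%N == j :> nat) = false by lia.
  by have -> : (l == j.-1 :> nat) = false by lia.
by have -> : ((1 + l)%N == j :> nat) = (l == j.-1 :> nat) by lia.
Qed.

Fact last_face_multilinear q : multilinear (fun a => tens (@last_face q a)).
Proof.
apply: multilinear_tens => a j.
have [j0|j0] := eqVneq (j : nat) 0.
  exists ord0, (fun x => a ord_max * x); split=> [c x y|x].
    by rewrite mulrDr scalerAr.
  apply/ffunP => l; rewrite !ffunE -!val_eqE /= j0.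
  by have [le|le] := eqVneq (l : nat) 0.
have [jm|jm] := eqVneq (j : nat) q.+1.
  exists ord0, (fun x => x * a ord0); split=> [c x y|x].
    by rewrite mulrDl scalerAl.
  apply/ffunP => l; rewrite !ffunE -!val_eqE /= jm eqxx /=.
  have [le|le] := eqVneq (l : nat) 0; first by [].
  by rewrite ltn_eqF //.
have jq : (j < q.+1)%N by have := ltn_ord j; lia.
exists (Ordinal jq), id; split=> // x.
apply/ffunP => l; rewrite !ffunE -!val_eqE /=.
have [le|le] := eqVneq (l : nat) 0; last by [].
have -> : (q.+1 == j :> nat) = false by lia.
have -> : (0 == j :> nat)%N = false by lia.
by have -> : (l == j :> nat) = false by lia.
Qed.

Fact rot_tuple_multilinear q : multilinear (fun a => tens (@rot_tuple q a)).
Proof.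
apply: multilinear_tens => a j; exists (ordS j), id; split=> // x.
apply/ffunP => l; rewrite !ffunE.
by rewrite (can2_eq (@ord_predK _) (@ordSK _)).
Qed.

End TupleOperators.

Section CyclicBicomplex.
Variables (F : fieldType) (A : algType F).

(* Operators of the cyclic bicomplex on A^{(x) q+1} (degree q):
   b' = \sum_(i < q.+1) (-1)^i d_i, b = b' + (-1)^(q+1) d_{q+1} from degree q+1
   to degree q, the signed cyclic operator t, and N = 1 + t + ... + t^q *)
Definition bprime q : tpow A q.+2 -> tpow A q.+1 :=
  tlift (fun a => \sum_(i < q.+1) (-1) ^+ i *: tens (face i a)).

Definition blast q : tpow A q.+2 -> tpow A q.+1 :=
  tlift (fun a => tens (last_face a)).

Definition hochb q (x : tpow A q.+2) : tpow A q.+1 :=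
  bprime x + (-1) ^+ q.+1 *: blast x.

Definition tunsigned q : tpow A q.+1 -> tpow A q.+1 :=
  tlift (fun a => tens (rot_tuple a)).

Definition tcyc q (x : tpow A q.+1) : tpow A q.+1 := (-1) ^+ q *: tunsigned x.

Definition tnorm q (x : tpow A q.+1) : tpow A q.+1 :=
  \sum_(i < q.+1) iter i (@tcyc q) x.

Fact bprime_linear q : linear (@bprime q).
Proof.
apply: tlift_linear; apply: multilinear_sum => i; exact: face_multilinear.
Qed.

HB.instance Definition _ q := GRing.isLinear.Build F (tpow A q.+2) (tpow A q.+1)
  *:%R (@bprime q) (@bprime_linear q).

Fact blast_linear q : linear (@blast q).
Proof. by apply: tlift_linear; exact: last_face_multilinear. Qed.

HB.instance Definition _ q := GRing.isLinear.Build F (tpow A q.+2) (tpow A q.+1)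
  *:%R (@blast q) (@blast_linear q).

Fact hochb_linear q : linear (@hochb q).
Proof.
move=> c x y; rewrite /hochb !linearP addrACA; congr (_ + _).
by rewrite scalerDr !scalerA mulrC.
Qed.

HB.instance Definition _ q := GRing.isLinear.Build F (tpow A q.+2) (tpow A q.+1)
  *:%R (@hochb q) (@hochb_linear q).

Fact tunsigned_linear q : linear (@tunsigned q).
Proof. by apply: tlift_linear; exact: rot_tuple_multilinear. Qed.

HB.instance Definition _ q := GRing.isLinear.Build F (tpow A q.+1) (tpow A q.+1)
  *:%R (@tunsigned q) (@tunsigned_linear q).

Fact tcyc_linear q : linear (@tcyc q).
Proof. by move=> c x y; rewrite /tcyc linearP scalerDr !scalerA mulrC. Qed.

HB.instance Definition _ q := GRing.isLinear.Build F (tpow A q.+1) (tpow A q.+1)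
  *:%R (@tcyc q) (@tcyc_linear q).

Fact tnorm_linear q : linear (@tnorm q).
Proof.
move=> c x y; rewrite /tnorm scaler_sumr -big_split; apply: eq_bigr => i _ /=.
by elim: (i : nat) => //= k ->; rewrite linearP.
Qed.

HB.instance Definition _ q := GRing.isLinear.Build F (tpow A q.+1) (tpow A q.+1)
  *:%R (@tnorm q) (@tnorm_linear q).

(* One total degree of the periodic cyclic bicomplex CC_{p,q} = A^{(x) q+1}
   (p in Z, q >= 0), totalized by direct products *)
Definition chains := forall q : nat, tpow A q.+1.

HB.instance Definition _ := Choice.on chains.

Fact chains_addA : associative (fun (x y : chains) q => x q + y q).
Proof. by move=> x y z; apply: functional_extensionality_dep => q; rewrite addrA. Qed.
Fact chains_addC : commutative (fun (x y : chains) q => x q + y q).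
Proof. by move=> x y; apply: functional_extensionality_dep => q; rewrite addrC. Qed.
Fact chains_add0 : left_id ((fun=> 0) : chains) (fun (x y : chains) q => x q + y q).
Proof. by move=> x; apply: functional_extensionality_dep => q; rewrite add0r. Qed.
Fact chains_addN : left_inverse ((fun=> 0) : chains) (fun (x : chains) q => - x q)
  (fun (x y : chains) q => x q + y q).
Proof. by move=> x; apply: functional_extensionality_dep => q; rewrite addNr. Qed.

HB.instance Definition _ := GRing.isZmodule.Build chains
  chains_addA chains_addC chains_add0 chains_addN.

Definition chains_scale (c : F) (x : chains) : chains := fun q => c *: x q.

Fact chains_scaleA a b x :
  chains_scale a (chains_scale b x) = chains_scale (a * b) x.
Proof. by apply: functional_extensionality_dep => q; rewrite /chains_scale scalerA. Qed.
Fact chains_scale1 : left_id 1 chains_scale.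
Proof. by move=> x; apply: functional_extensionality_dep => q; rewrite /chains_scale scale1r. Qed.
Fact chains_scaleDr : right_distributive chains_scale +%R.
Proof. by move=> a x y; apply: functional_extensionality_dep => q; rewrite /chains_scale scalerDr. Qed.
Fact chains_scaleDl x : {morph chains_scale^~ x : a b / a + b}.
Proof. by move=> a b; apply: functional_extensionality_dep => q; rewrite /chains_scale scalerDl. Qed.

HB.instance Definition _ := GRing.Zmodule_isLmodule.Build F chains
  chains_scaleA chains_scale1 chains_scaleDr chains_scaleDl.

(* Total differential from a degree of parity m. Even columns carry b, odd
   columns carry -b'; horizontally 1 - t goes from odd to even columns and N from
   even to odd ones. The component in row q lands in the column of index
   m - 1 - q, which is even exactly when m (+) odd q. *)
Definition hpd (m : bool) (x : chains) : chains := fun q =>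
  if m (+) odd q then hochb (x q.+1) + (x q - tcyc (x q))
  else - bprime (x q.+1) + tnorm (x q).

Fact hpd_linear m : linear (hpd m).
Proof.
move=> c x y; apply: functional_extensionality_dep => q.
rewrite -[LHS]/(hpd m (c *: x + y) q) -[RHS]/(c *: hpd m x q + hpd m y q) /hpd.
rewrite -![(c *: x + y) _]/(c *: x _ + y _).
case: ifP => _.
  rewrite hochb_linear tcyc_linear.
  rewrite !scalerDr scalerN [RHS]addrACA; congr (_ + _).
  by rewrite opprD addrACA.
by rewrite bprime_linear tnorm_linear opprD scalerDr scalerN addrACA.
Qed.

HB.instance Definition _ m := GRing.isLinear.Build F chains chains *:%R
  (hpd m) (@hpd_linear m).

(* The total complex is 2-periodic, hence HP_* is indexed by the parity m:
   HP A false is HP_0 and HP A true is HP_1 *)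
Definition HP (m : bool) : lmodType F := homology (hpd (~~ m)) (hpd m).

End CyclicBicomplex.

Section Functoriality.
Variables (F : fieldType) (A A' : algType F) (f : {lrmorphism A -> A'}).

Definition tuple_map n (a : {ffun 'I_n -> A}) : {ffun 'I_n -> A'} :=
  [ffun j => f (a j)].

Definition tpow_map n : tpow A n -> tpow A' n := tlift (fun a => tens (tuple_map a)).

Fact tuple_map_multilinear n : multilinear (fun a => tens (@tuple_map n a)).
Proof.
apply: multilinear_tens => a j; exists j, f; split; first exact: linearP.
by move=> x; apply/ffunP => l; rewrite !ffunE; case: ifP.
Qed.

Fact tpow_map_linear n : linear (@tpow_map n).
Proof. by apply: tlift_linear; exact: tuple_map_multilinear. Qed.

HB.instance Definition _ n := GRing.isLinear.Build F (tpow A n) (tpow A' n)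
  *:%R (@tpow_map n) (@tpow_map_linear n).

Lemma tpow_map_tens n a : tpow_map (tens a) = tens (@tuple_map n a).
Proof. by rewrite /tpow_map tlift_tens //; exact: tuple_map_multilinear. Qed.

Lemma tpow_map_bprime q x : tpow_map (@bprime _ A q x) = bprime (tpow_map x).
Proof.
apply: (@tpow_ext F A q.+2 _ (@tpow_map q.+1 \o @bprime _ A q)
  (@bprime _ A' q \o @tpow_map q.+2)) => a /=.
rewrite tpow_map_tens /bprime !tlift_tens; last 2 first.
- by apply: multilinear_sum => i; exact: face_multilinear.
- by apply: multilinear_sum => i; exact: face_multilinear.
rewrite linear_sum; apply: eq_bigr => i _.
rewrite linearZ /= tpow_map_tens; congr (_ *: tens _).
by apply/ffunP => j; rewrite !ffunE; do 2?case: ifP; rewrite ?rmorphM.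
Qed.

Lemma tpow_map_blast q x : tpow_map (@blast _ A q x) = blast (tpow_map x).
Proof.
apply: (@tpow_ext F A q.+2 _ (@tpow_map q.+1 \o @blast _ A q)
  (@blast _ A' q \o @tpow_map q.+2)) => a /=.
rewrite tpow_map_tens /blast !tlift_tens; last 2 first.
- exact: last_face_multilinear.
- exact: last_face_multilinear.
rewrite tpow_map_tens; congr (tens _).
by apply/ffunP => j; rewrite !ffunE; case: ifP; rewrite ?rmorphM.
Qed.

Lemma tpow_map_hochb q x : tpow_map (@hochb _ A q x) = hochb (tpow_map x).
Proof.
by rewrite /hochb linearD linearZ /= tpow_map_bprime tpow_map_blast.
Qed.

Lemma tpow_map_tcyc q x : tpow_map (@tcyc _ A q x) = tcyc (tpow_map x).
Proof.
rewrite /tcyc linearZ /=; congr (_ *: _).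
apply: (@tpow_ext F A q.+1 _ (@tpow_map q.+1 \o @tunsigned _ A q)
  (@tunsigned _ A' q \o @tpow_map q.+1)) => a /=.
rewrite tpow_map_tens /tunsigned !tlift_tens; last 2 first.
- exact: rot_tuple_multilinear.
- exact: rot_tuple_multilinear.
by rewrite tpow_map_tens; congr (tens _); apply/ffunP => j; rewrite !ffunE.
Qed.

Lemma tpow_map_tnorm q x : tpow_map (@tnorm _ A q x) = tnorm (tpow_map x).
Proof.
rewrite /tnorm linear_sum; apply: eq_bigr => i _ /=.
by elim: (i : nat) => //= k <-; rewrite tpow_map_tcyc.
Qed.

Definition chains_map (x : chains A) : chains A' := fun q => tpow_map (x q).

Fact chains_map_linear : linear chains_map.
Proof.
move=> c x y; apply: functional_extensionality_dep => q.
exact: (linearP (@tpow_map q.+1)).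
Qed.

HB.instance Definition _ := GRing.isLinear.Build F (chains A) (chains A')
  *:%R chains_map chains_map_linear.

Lemma chains_map_hpd m x : chains_map (hpd m x) = hpd m (chains_map x).
Proof.
apply: functional_extensionality_dep => q; rewrite /chains_map /hpd.
case: ifP => _; rewrite linearD.
  by rewrite linearB /= tpow_map_hochb tpow_map_tcyc.
by rewrite linearN /= tpow_map_bprime tpow_map_tnorm.
Qed.

Definition HP_map (m : bool) : HP A m -> HP A' m :=
  homology_map (d := hpd (~~ m)) (hpd (~~ m)) (chains_map_hpd m).

Fact HP_map_linear m : linear (@HP_map m).
Proof. exact: (homology_map_linear (chains_map_hpd (~~ m))). Qed.

HB.instance Definition _ m := GRing.isLinear.Build F (HP A m) (HP A' m) *:%R
  (@HP_map m) (@HP_map_linear m).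

End Functoriality.

Arguments HP {F} A m.
Arguments HP_map {F A A'} f m _.

Definition noetherian (k : comNzRingType) : Prop :=
  forall I : set k,
    I 0 -> (forall x y, I x -> I y -> I (x + y)) ->
    (forall a x, I x -> I (a * x)) ->
  exists s : seq k, I = [set \sum_(l < size s) c l * s`_l | c in [set: 'I_(size s) -> k]].

Definition affine_algebra (k : comNzRingType) (B : comAlgType k) : Prop :=
  exists s : seq B, forall S : set B,
    (forall c : k, S c%:A) ->
    (forall x y, S x -> S y -> S (x + y)) ->
    (forall x y, S x -> S y -> S (x * y)) ->
    (forall x, x \in s -> S x) ->
  S = [set: B].

(* 0 is a zero-divisor, as rings of type comNzRingType are nonzero *)
Definition zero_divisor (B : comNzRingType) (x : B) : Prop :=
  exists2 y, y != 0 & x * y = 0.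

Definition involution (k : comNzRingType) (A : algType k) (i : A -> A) : Prop :=
  [/\ linear i, forall x y, i (x * y) = i y * i x & involutive i].

Section TwoSidedIdeals.
Variable A : nzRingType.

Record ideal2 (J : set A) : Prop := Ideal2 {
  ideal2_0 : J 0;
  ideal2_D : forall x y, J x -> J y -> J (x + y);
  ideal2_Ml : forall a x, J x -> J (a * x);
  ideal2_Mr : forall a x, J x -> J (x * a)
}.

Definition ideal_mul (I J : set A) : set A :=
  [set x | exists m (y z : 'I_m -> A),
    [/\ forall l, I (y l), forall l, J (z l) & x = \sum_l y l * z l]].

Definition idempotent_ideal (J : set A) : Prop := ideal_mul J J = J.

Record proper_ideal2 := ProperIdeal2 {
  pideal_set :> A -> Prop;
  pideal_ideal2 : ideal2 pideal_set;
  pideal_proper : ~ pideal_set 1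
}.

End TwoSidedIdeals.

Section QuotientAlgebra.
Variables (k : comNzRingType) (A : algType k) (I : proper_ideal2 A).

Fact pideal_lin c x y : I x -> I y -> I (c *: x + y).
Proof.
move=> Ix Iy; apply: (ideal2_D (pideal_ideal2 I)) => //.
by rewrite -mulr_algl; exact: (ideal2_Ml (pideal_ideal2 I)).
Qed.

Definition pideal_submodule := Submodule (ideal2_0 (pideal_ideal2 I)) pideal_lin.

Definition quot_alg : Type := lquot pideal_submodule.

HB.instance Definition _ := GRing.Lmodule.on quot_alg.

Definition qpi : A -> quot_alg := lpi pideal_submodule.

HB.instance Definition _ := GRing.Linear.on qpi.

Lemma qpiE x y : qpi x = qpi y <-> I (x - y).
Proof. exact: (lpiE pideal_submodule). Qed.

Lemma qpi_surj (q : quot_alg) : exists x, q = qpi x.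
Proof. exact: (lpi_surj (S := pideal_submodule)). Qed.

Lemma qpi_repr (q : quot_alg) : qpi (repr (q : lquot pideal_submodule)) = q.
Proof. exact: (lpi_repr (S := pideal_submodule)). Qed.

Definition quot_mul (p q : quot_alg) : quot_alg :=
  qpi (repr (p : lquot pideal_submodule) * repr (q : lquot pideal_submodule)).

Lemma qpiM : {morph qpi : x y / x * y >-> quot_mul x y}.
Proof.
move=> x y; apply/qpiE; set x' := repr _; set y' := repr _.
have -> : x * y - x' * y' = (x - x') * y + x' * (y - y').
  by rewrite mulrBl mulrBr addrA addrNK.
apply: (ideal2_D (pideal_ideal2 I)).
  by apply: (ideal2_Mr (pideal_ideal2 I)); apply/qpiE; rewrite qpi_repr.
by apply: (ideal2_Ml (pideal_ideal2 I)); apply/qpiE; rewrite qpi_repr.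
Qed.

Fact quot_mulA : associative quot_mul.
Proof.
move=> p q r; have [x ->] := qpi_surj p; have [y ->] := qpi_surj q.
by have [z ->] := qpi_surj r; rewrite -!qpiM mulrA.
Qed.

Fact quot_mul1q : left_id (qpi 1) quot_mul.
Proof. by move=> p; have [x ->] := qpi_surj p; rewrite -qpiM mul1r. Qed.

Fact quot_mulq1 : right_id (qpi 1) quot_mul.
Proof. by move=> p; have [x ->] := qpi_surj p; rewrite -qpiM mulr1. Qed.

Fact quot_mulDl : left_distributive quot_mul +%R.
Proof.
move=> p q r; have [x ->] := qpi_surj p; have [y ->] := qpi_surj q.
by have [z ->] := qpi_surj r; rewrite -raddfD -!qpiM mulrDl raddfD.
Qed.

Fact quot_mulDr : right_distributive quot_mul +%R.
Proof.
move=> p q r; have [x ->] := qpi_surj p; have [y ->] := qpi_surj q.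
by have [z ->] := qpi_surj r; rewrite -raddfD -!qpiM mulrDr raddfD.
Qed.

Fact quot_1neq0 : qpi 1 != 0.
Proof.
apply/eqP; rewrite -(raddf0 qpi) => /qpiE; rewrite subr0.
exact: pideal_proper.
Qed.

HB.instance Definition _ := GRing.Zmodule_isNzRing.Build quot_alg
  quot_mulA quot_mul1q quot_mulq1 quot_mulDl quot_mulDr quot_1neq0.

Fact qpi_monoid_morphism : monoid_morphism qpi.
Proof. by split=> // x y; rewrite qpiM. Qed.

HB.instance Definition _ := GRing.isMonoidMorphism.Build A quot_alg qpi
  qpi_monoid_morphism.

Fact quot_scaleAl c (p q : quot_alg) : c *: (p * q) = (c *: p) * q.
Proof.
have [x ->] := qpi_surj p; have [y ->] := qpi_surj q.
by rewrite -rmorphM -!linearZ -rmorphM /= scalerAl.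
Qed.

HB.instance Definition _ := GRing.Lmodule_isLalgebra.Build k quot_alg quot_scaleAl.

Fact quot_scaleAr c (p q : quot_alg) : c *: (p * q) = p * (c *: q).
Proof.
have [x ->] := qpi_surj p; have [y ->] := qpi_surj q.
by rewrite -rmorphM -!linearZ -rmorphM /= scalerAr.
Qed.

HB.instance Definition _ := GRing.Lalgebra_isAlgebra.Build k quot_alg quot_scaleAr.

(* The map induced by i on A / I; meaningful when i maps I to itself *)
Definition quot_invol (i : A -> A) (q : quot_alg) : quot_alg :=
  qpi (i (repr (q : lquot pideal_submodule))).

End QuotientAlgebra.

Arguments qpi {k A} I x.
Arguments quot_invol {k A} I i q.

Section AffineCell.
Variables (k : comNzRingType) (A : algType k) (i : A -> A) (J : set A).

(* With V = k^d and its standard basis, V (x)_k B is 'cV[B]_d, B (x)_k V is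
   'rV[B]_d, and Delta (x)_B Delta', i.e. V (x)_k B (x)_k V, is 'M[B]_d by
   v (x) w |-> v *m w. In a datum, cell_act is the left A-action on Delta,
   cell_form the swich matrix psi, cell_iso the map alpha (only its restriction
   to J matters) and cell_isoV its inverse. *)
Record cell_datum := CellDatum {
  cell_ring : comAlgType k;
  cell_invol : cell_ring -> cell_ring;
  cell_rank : nat;
  cell_act : A -> 'cV[cell_ring]_cell_rank -> 'cV[cell_ring]_cell_rank;
  cell_form : 'M[cell_ring]_cell_rank;
  cell_iso : A -> 'M[cell_ring]_cell_rank;
  cell_isoV : 'M[cell_ring]_cell_rank -> A
}.

Variable D : cell_datum.
Local Notation B := (cell_ring D).
Local Notation d := (cell_rank D).
Local Notation alpha := (@cell_iso D).
Local Notation alphaV := (@cell_isoV D).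
Local Notation act := (@cell_act D).

(* The right A-action (b (x) v) a = tau (i(a) (v (x) b)) on Delta' *)
Definition cell_ract (w : 'rV[B]_d) (a : A) : 'rV[B]_d := (act (i a) w^T)^T.

Record affine_cell_ideal : Prop := AffineCellIdeal {
  cell_involution : involution i;
  cell_ideal2 : ideal2 J;
  cell_ideal_stable : i @` J = J;
  cell_ring_affine : affine_algebra B;
  cell_invol_involution : involution (@cell_invol D);
  cell_rank_gt0 : (0 < d)%N;
  cell_actD : forall a b v, act (a + b) v = act a v + act b v;
  cell_actM : forall a b v, act (a * b) v = act a (act b v);
  cell_act1 : forall v, act 1 v = v;
  cell_act_linear : forall a, linear (act a);
  cell_actZ : forall (c : k) a v, act (c *: a) v = c%:A *: act a v;
  cell_isoD : forall x y, J x -> J y -> alpha (x + y) = alpha x + alpha y;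
  cell_isoVP : forall X, J (alphaV X);
  cell_isoVK : forall X, alpha (alphaV X) = X;
  cell_isoK : forall x, J x -> alphaV (alpha x) = x;
  (* a (v *m w) = (a v) *m w and (v *m w) a = v *m (w a), read on the columns and
     on the rows of a matrix *)
  cell_iso_left : forall a x, J x ->
    forall s, col s (alpha (a * x)) = act a (col s (alpha x));
  cell_iso_right : forall a x, J x ->
    forall r, row r (alpha (x * a)) = cell_ract (row r (alpha x)) a;
  cell_iso_invol : forall x, J x ->
    alpha (i x) = map_mx (@cell_invol D) (alpha x)^T;
  cell_iso_form : forall x y, J x -> J y ->
    alpha (x * y) = alpha x *m cell_form D *m alpha y
}.

Hypothesis HD : affine_cell_ideal.

Definition cell_act_mx (a : A) : 'M[B]_d := \matrix_(r, s) act a (delta_mx s 0) r 0.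

Lemma cell_act_mxE a v : act a v = cell_act_mx a *m v.
Proof.
have h0 : act a 0 = 0.
  have := cell_act_linear HD a (-1) 0 0.
  by rewrite scaler0 addr0 scaleN1r addNr.
have hZ c x : act a (c *: x) = c *: act a x.
  by have := cell_act_linear HD a c x 0; rewrite h0 !addr0.
have hD x y : act a (x + y) = act a x + act a y.
  by have := cell_act_linear HD a 1 x y; rewrite !scale1r.
have hS (f : 'I_d -> 'cV[B]_d) : act a (\sum_s f s) = \sum_s act a (f s).
  by elim/big_rec2: _ => // s x y _ <-; rewrite hD.
rewrite {1}[v]matrix_sum_delta.
apply/colP => r; rewrite mxE.
have -> : \sum_(r < d) \sum_(s < 1) v r s *: delta_mx r s
   = \sum_(r < d) v r 0 *: delta_mx r 0 by apply: eq_bigr => l _; rewrite big_ord1.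
rewrite hS summxE; apply: eq_bigr => s _.
by rewrite hZ !mxE mulrC.
Qed.

Lemma cell_iso_mull a x : J x -> alpha (a * x) = cell_act_mx a *m alpha x.
Proof.
move=> Jx; apply/matrixP => r s.
have := congr1 (fun w : 'cV[B]_d => w r 0) (cell_iso_left HD a Jx s).
by rewrite cell_act_mxE !mxE => ->; apply: eq_bigr => l _; rewrite !mxE.
Qed.

Lemma cell_iso_mulr a x : J x -> alpha (x * a) = alpha x *m (cell_act_mx (i a))^T.
Proof.
move=> Jx; apply/matrixP => r s.
have := congr1 (fun w : 'rV[B]_d => w 0 s) (cell_iso_right HD a Jx r).
rewrite /cell_ract cell_act_mxE trmx_mul trmxK !mxE => ->.
by apply: eq_bigr => l _; rewrite !mxE.
Qed.

Definition cell_one : A := alphaV (1%:M : 'M[B]_d).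

Definition cell_embed (a : A) : 'M[B]_d := alpha (a * cell_one).

Lemma cell_embedE a : cell_embed a = cell_act_mx a.
Proof.
rewrite /cell_embed cell_iso_mull; last exact: (cell_isoVP HD).
by rewrite /cell_one (cell_isoVK HD) mulmx1.
Qed.

Lemma cell_embedB : zmod_morphism cell_embed.
Proof.
have JN x : J x -> J (- x).
  by rewrite -mulN1r; exact: (ideal2_Ml (cell_ideal2 HD)).
move=> a b; rewrite /cell_embed mulrBl.
have Jm c : J (c * cell_one).
  by apply: (ideal2_Ml (cell_ideal2 HD)); exact: (cell_isoVP HD).
apply/eqP; rewrite eq_sym subr_eq -(cell_isoD HD) ?subrK //.
by apply: (ideal2_D (cell_ideal2 HD)) => //; exact: JN.
Qed.

Lemma cell_embed1 : cell_embed 1 = 1.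
Proof. by rewrite /cell_embed mul1r /cell_one (cell_isoVK HD). Qed.

Lemma cell_embedM a b : cell_embed (a * b) = cell_embed a * cell_embed b.
Proof.
have Jb : J (b * cell_one).
  by apply: (ideal2_Ml (cell_ideal2 HD)); exact: (cell_isoVP HD).
rewrite [cell_embed a]cell_embedE /cell_embed -mulrA.
by rewrite cell_iso_mull.
Qed.

Lemma cell_embed_central c : (forall x, c * x = x * c) ->
  forall X, cell_embed c *m X = X *m cell_embed c.
Proof.
move=> cC; have J1 := cell_isoVP HD (1%:M).
have key X : cell_embed c *m X = X *m (cell_act_mx (i c))^T.
  have JX := cell_isoVP HD X; rewrite -(cell_isoVK HD X) cell_embedE.
  by rewrite -cell_iso_mull // cC cell_iso_mulr.
have e : cell_embed c = (cell_act_mx (i c))^T.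
  by have := key 1%:M; rewrite mulmx1 mul1mx.
by move=> X; rewrite key -e.
Qed.

End AffineCell.

Section AffineCellular.
Variables (k : comNzRingType) (A : algType k) (i : A -> A).

(* J_m, the sum of the first m parts *)
Definition partial_sum n (P : 'I_n -> submodule A) (m : nat) : set A :=
  [set \sum_(l < n | (l < m)%N) x l | x in [set x : 'I_n -> A | forall l, P l (x l)]].

(* Layers are numbered from 0: for j : 'I_n, ac_part j is J'_{j+1}, ac_ideal j
   is J_j, which is proper because the chain is strict and ends at A, and
   ac_cell j is the cell datum of J_{j+1} / J_j as an ideal of A / J_j. *)
Record affineCellular := AffineCellular {
  ac_len : nat;
  ac_part : 'I_ac_len -> submodule A;
  ac_ideal : 'I_ac_len -> proper_ideal2 A;
  ac_cell : forall j, cell_datum (quot_alg (ac_ideal j));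
  ac_involution : involution i;
  ac_part_stable : forall j, i @` (ac_part j : set A) = ac_part j;
  ac_direct : forall a, exists! x : 'I_ac_len -> A,
    (forall j, ac_part j (x j)) /\ a = \sum_j x j;
  ac_idealE : forall j, pideal_set (ac_ideal j) = partial_sum ac_part j;
  ac_cellP : forall j, affine_cell_ideal (quot_invol (ac_ideal j) i)
    (qpi (ac_ideal j) @` partial_sum ac_part j.+1) (ac_cell j)
}.

Variable X : affineCellular.
Local Notation n := (ac_len X).

(* J_{j+1} / J_j *)
Definition layer (j : 'I_n) : set (quot_alg (ac_ideal j)) :=
  qpi (ac_ideal j) @` partial_sum (@ac_part X) j.+1.

Definition swich (j : 'I_n) := cell_form (ac_cell j).

(* The asymptotic algebra *)
Definition asym : Type :=
  forall j : 'I_n, 'M[cell_ring (ac_cell j)]_(cell_rank (ac_cell j)).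

HB.instance Definition _ := Choice.on asym.

Fact asym_addA : associative (fun (x y : asym) j => x j + y j).
Proof. by move=> x y z; apply: functional_extensionality_dep => j; rewrite addrA. Qed.
Fact asym_addC : commutative (fun (x y : asym) j => x j + y j).
Proof. by move=> x y; apply: functional_extensionality_dep => j; rewrite addrC. Qed.
Fact asym_add0 : left_id ((fun=> 0) : asym) (fun (x y : asym) j => x j + y j).
Proof. by move=> x; apply: functional_extensionality_dep => j; rewrite add0r. Qed.
Fact asym_addN : left_inverse ((fun=> 0) : asym) (fun (x : asym) j => - x j)
  (fun (x y : asym) j => x j + y j).
Proof. by move=> x; apply: functional_extensionality_dep => j; rewrite addNr. Qed.

HB.instance Definition _ := GRing.isZmodule.Build asym
  asym_addA asym_addC asym_add0 asym_addN.

Definition asym_one : asym := fun j => 1%:M.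
Definition asym_mul (x y : asym) : asym := fun j => x j *m y j.

Fact asym_mulA : associative asym_mul.
Proof. by move=> x y z; apply: functional_extensionality_dep => j; exact: mulmxA. Qed.
Fact asym_mul1x : left_id asym_one asym_mul.
Proof. by move=> x; apply: functional_extensionality_dep => j; exact: mul1mx. Qed.
Fact asym_mulx1 : right_id asym_one asym_mul.
Proof. by move=> x; apply: functional_extensionality_dep => j; exact: mulmx1. Qed.
Fact asym_mulDl : left_distributive asym_mul +%R.
Proof. by move=> x y z; apply: functional_extensionality_dep => j; exact: mulmxDl. Qed.
Fact asym_mulDr : right_distributive asym_mul +%R.
Proof. by move=> x y z; apply: functional_extensionality_dep => j; exact: mulmxDr. Qed.

Fact asym_1neq0 : asym_one != 0.
Proof.
apply/eqP => e.
have [j _] : exists j : 'I_n, True.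
  have [x [[_ x1] _]] := ac_direct X 1.
  have [n0|] := posnP n; last by move=> n0; exists (Ordinal n0).
  case/eqP: (oner_neq0 A); rewrite x1 big1 // => l.
  by move: (ltn_ord l); rewrite [X in (_ < X)%N -> _]n0.
have d0 := cell_rank_gt0 (ac_cellP j).
have := congr1 (fun x : asym => x j (Ordinal d0) (Ordinal d0)) e.
by rewrite /asym_one !mxE eqxx => /eqP; rewrite oner_eq0.
Qed.

HB.instance Definition _ := GRing.Zmodule_isNzRing.Build asym
  asym_mulA asym_mul1x asym_mulx1 asym_mulDl asym_mulDr asym_1neq0.

Definition Theta (a : A) : asym :=
  fun j => cell_embed (ac_cell j) (qpi (ac_ideal j) a).

Fact Theta_zmod_morphism : zmod_morphism Theta.
Proof.
move=> a b; apply: functional_extensionality_dep => j.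
by rewrite /Theta rmorphB (cell_embedB (ac_cellP j)).
Qed.

Fact Theta_monoid_morphism : monoid_morphism Theta.
Proof.
split=> [|a b]; apply: functional_extensionality_dep => j; rewrite /Theta.
  by rewrite rmorph1 (cell_embed1 (ac_cellP j)).
by rewrite rmorphM (cell_embedM (ac_cellP j)).
Qed.

HB.instance Definition _ := GRing.isZmodMorphism.Build A asym Theta
  Theta_zmod_morphism.
HB.instance Definition _ := GRing.isMonoidMorphism.Build A asym Theta
  Theta_monoid_morphism.

Lemma Theta_central c : (forall a, c * a = a * c) ->
  forall x : asym, Theta c * x = x * Theta c.
Proof.
move=> cC x; apply: functional_extensionality_dep => j.
apply: (cell_embed_central (ac_cellP j)) => q.
by have [a ->] := qpi_surj q; rewrite -!rmorphM cC.
Qed.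

End AffineCellular.

Arguments layer {k A i} X j.
Arguments swich {k A i} X j.
Arguments Theta {k A i} X a.

Record central_hom (F : comNzRingType) (A : nzRingType) := CentralHom {
  ch_map :> {rmorphism F -> A};
  ch_central : forall c a, ch_map c * a = a * ch_map c
}.

(* A with the F-algebra structure c *: a = eta c * a; A may carry another,
   unrelated algebra structure *)
Definition scalar_alg (F : comNzRingType) (A : nzRingType)
  (eta : central_hom F A) : Type := A.

Section RestrictScalars.
Variables (F : comNzRingType) (A : nzRingType) (eta : central_hom F A).
Local Notation scalar_alg := (scalar_alg eta).

HB.instance Definition _ := GRing.NzRing.on scalar_alg.

Definition scalar_scale (c : F) (a : scalar_alg) : scalar_alg := eta c * a.

Fact scalar_scaleA a b x :
  scalar_scale a (scalar_scale b x) = scalar_scale (a * b) x.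
Proof. by rewrite /scalar_scale rmorphM mulrA. Qed.
Fact scalar_scale1 : left_id 1 scalar_scale.
Proof. by move=> x; rewrite /scalar_scale rmorph1 mul1r. Qed.
Fact scalar_scaleDr : right_distributive scalar_scale +%R.
Proof. by move=> a x y; rewrite /scalar_scale mulrDr. Qed.
Fact scalar_scaleDl x : {morph scalar_scale^~ x : a b / a + b}.
Proof. by move=> a b; rewrite /scalar_scale rmorphD mulrDl. Qed.

HB.instance Definition _ := GRing.Zmodule_isLmodule.Build F scalar_alg
  scalar_scaleA scalar_scale1 scalar_scaleDr scalar_scaleDl.

Fact scalar_scaleAl c (x y : scalar_alg) : c *: (x * y) = (c *: x) * y.
Proof. exact: mulrA. Qed.

HB.instance Definition _ := GRing.Lmodule_isLalgebra.Build F scalar_alg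
  scalar_scaleAl.

Fact scalar_scaleAr c (x y : scalar_alg) : c *: (x * y) = x * (c *: y).
Proof. by rewrite -[LHS]/(eta c * (_ * _)) mulrA ch_central -mulrA. Qed.

HB.instance Definition _ := GRing.Lalgebra_isAlgebra.Build F scalar_alg
  scalar_scaleAr.

End RestrictScalars.

Definition finite_module (K : comNzRingType) (A : nzRingType)
    (phi : central_hom K A) : Prop :=
  exists s : seq A, forall a, exists c : 'I_(size s) -> K,
    a = \sum_(l < size s) phi (c l) * s`_l.

Section ScalarStructures.
Variables (F : fieldType) (K : comAlgType F) (k : comNzRingType) (A : algType k).
Variable phi : central_hom K A.

Fact base_central c a : phi (in_alg K c) * a = a * phi (in_alg K c).
Proof. exact: ch_central. Qed.

Definition base_hom : central_hom F A :=
  @CentralHom F A (phi \o in_alg K) base_central.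

Variables (i : A -> A) (X : affineCellular i).

Fact asym_base_central c x :
  Theta X (phi (in_alg K c)) * x = x * Theta X (phi (in_alg K c)).
Proof. by apply: Theta_central => a; exact: ch_central. Qed.

(* Theta maps the center of A to the center of the asymptotic algebra, which thus
   becomes an F-algebra; this is the only structure making Theta F-linear *)
Definition asym_base_hom : central_hom F (asym X) :=
  @CentralHom F (asym X) (Theta X \o (phi \o in_alg K)) asym_base_central.

Definition Theta_fun : scalar_alg base_hom -> scalar_alg asym_base_hom := Theta X.

HB.instance Definition _ := GRing.isZmodMorphism.Build (scalar_alg base_hom)
  (scalar_alg asym_base_hom) Theta_fun (Theta_zmod_morphism X).
HB.instance Definition _ := GRing.isMonoidMorphism.Build (scalar_alg base_hom)
  (scalar_alg asym_base_hom) Theta_fun (Theta_monoid_morphism X).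

Fact Theta_scalable : scalable Theta_fun.
Proof. by move=> c x; exact: (rmorphM (Theta X)). Qed.

HB.instance Definition _ := GRing.isScalable.Build F (scalar_alg base_hom)
  (scalar_alg asym_base_hom) *:%R Theta_fun Theta_scalable.

Definition Theta_alg :
    {lrmorphism (scalar_alg base_hom : algType F) ->
                (scalar_alg asym_base_hom : algType F)} :=
  Theta_fun.

End ScalarStructures.

Arguments Theta_alg {F K k A} phi {i} X.

(* Main.v *)
(* Theta is filtered by embeddings each of which induces an isomorphism of HP by
   excision, with explicit homotopies.

   Let E be the asymptotic algebra, and let A_m be the set of the x in E that agree
   with some Theta(a) in the components j >= m, so that A_0 = Theta(A) and A_n = E.
   Let I be the m-th factor M_d(B) of E. As det(psi) is not a zero-divisor, an
   element of A that Theta kills in all components > m lies in J_{m+1}, so A_m meets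
   I in L = M_d(B) psi, a left ideal of I, and A_{m+1} = A_m + I. Idempotency of the
   layer says that the unit of I is a sum of products l_i r_i with l_i in L and r_i
   in I.

   Then the Hochschild complex of A_m is quasi-isomorphic to that of A_{m+1}:
   filter words by the position of their first letter in I. For a position p > 0,
   x |-> l_i (x) (r_i x) at p contracts the p-th subquotient (L is right projective
   over A_m with L^2 = L). For p = 0, the homomorphism x |-> (r_i x l_j) from I to
   matrices over L, followed by the generalized trace, is homotopic to the identity.
   A linear projection of E sending A_m into L and fixing I makes these homotopies
   preserve the words with letters in A_m.

   The columns of the cyclic bicomplex carry b or -b' (the latter contractible as
   1 is in A_0), and a chain map exact relative to each column is a
   quasi-isomorphism on the product total complex, by solving row after row. *)

Require Import Defs.
From HB Require Import structures.
From mathcomp Require Import all_boot all_order all_algebra.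
From mathcomp Require Import boolp classical_sets zify.
From mathcomp Require Import reals complex.

Set Implicit Arguments.
Unset Strict Implicit.
Unset Printing Implicit Defensive.

Import GRing.Theory.
Local Open Scope classical_set_scope.
Local Open Scope ring_scope.

(** * Linear algebra *)

Section LinearExtension.
Variables (F : fieldType) (V W : lmodType F) (C : submodule W).

(** Graph of a linear map from a subspace of [V] into [C]; by linearity, single-valuedness need only
    be asked at 0. *)
Definition functional_graph (G : set (V * W)) : Prop :=
  [/\ G (0, 0),
      forall c v w v' w', G (v, w) -> G (v', w') ->
        G (c *: v + v', c *: w + w'),
      forall w, G (0, w) -> w = 0 & forall v w, G (v, w) -> C w].

(** By Zorn's lemma there is a maximal such graph, and it is total: a vector outside its domain
    could still be sent to 0, a value that lies in [C]. This yields retractions and projections of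
    vector spaces. *)
Lemma linear_extension (G : set (V * W)) : functional_graph G ->
  exists f : {linear V -> W},
    (forall v w, G (v, w) -> f v = w) /\ (forall v, C (f v)).
Proof.
move=> [G0 Glin Gfun GC].
pose ok (H : set (V * W)) :=
  [/\ forall c v w v' w', H (v, w) -> H (v', w') -> H (c *: v + v', c *: w + w'),
      forall w, H (0, w) -> w = 0 & forall v w, H (v, w) -> C w].
(* sets are enlarged by G so that the empty chain causes no trouble *)
pose P := fun X : set (V * W) => ok (X `|` G)%classic.
have chain (Fam : set (set (V * W))) : (Fam `<=` P)%classic ->
    total_on Fam subset -> P (\bigcup_(X in Fam) X)%classic.
  move=> FP Ftot.
  have pick2 x y : ((\bigcup_(X in Fam) X) `|` G)%classic x ->
      ((\bigcup_(X in Fam) X) `|` G)%classic y ->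
      exists X, ok (X `|` G)%classic /\
       [/\ (X `|` G)%classic x, (X `|` G)%classic y &
        (X `|` G `<=` (\bigcup_(X in Fam) X) `|` G)%classic].
    have sub X : Fam X -> (X `|` G `<=` (\bigcup_(X in Fam) X) `|` G)%classic.
      by move=> FX z [Xz|Gz]; [left; exists X | right].
    move=> [[X FX Xx]|Gx] [[Y FY Yy]|Gy].
    - have [XY|YX] := Ftot _ _ FX FY.
        by exists Y; split; [exact: FP|split; [left; exact: XY|left|exact: sub]].
      by exists X; split; [exact: FP|split; [left|left; exact: YX|exact: sub]].
    - by exists X; split; [exact: FP|split; [left|right|exact: sub]].
    - by exists Y; split; [exact: FP|split; [right|left|exact: sub]].
    - exists set0; split; first by rewrite set0U.
      by split; [right|right|move=> z [//|Gz]; right].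
  split=> [c v w v' w' vw vw'|w w0|v w vw].
  - by have [X [[lX _ _] [Xv Xv' sX]]] := pick2 _ _ vw vw'; apply: sX; exact: lX.
  - by have [X [[_ fX _] [Xv _ _]]] := pick2 _ _ w0 w0; exact: fX.
  - by have [X [[_ _ cX] [Xv _ _]]] := pick2 _ _ vw vw; exact: cX Xv.
have [X [PX Xmax]] := Zorn_bigcup chain.
pose H := (X `|` G)%classic.
have [Hlin Hfun HC] : ok H by [].
have H0 : H (0, 0) by right.
have Htot v : exists w, H (v, w).
  apply: contrapT => nHv.
  (* [H'] extends the graph by the value 0 on the line through [v]. *)
  pose H' := [set p : V * W | exists c u, H (u, p.2) /\ p.1 = c *: v + u].
  have HH' : (H `<=` H')%classic.
    by move=> [u w] Hu; exists 0, u; rewrite scale0r add0r.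
  have H'v : H' (v, 0) by exists 1, 0; rewrite scale1r addr0.
  apply: (Xmax H').

    split; first by move=> x Xx; apply: HH'; left.
    by move/(_ _ H'v) => Xv; apply: nHv; exists 0; left.
  rewrite /P (_ : (H' `|` G)%classic = H'); last first.
    by apply/seteqP; split=> [x [//|Gx]|x]; [apply: HH'; right|left].
  split.
  - move=> c u w u' w' [a [x [/= xw ->]]] [a' [x' [/= xw' ->]]].
    exists (c * a + a'), (c *: x + x'); split; first exact: Hlin.
    by rewrite /= scalerDl scalerDr scalerA addrACA.
  (* If [a] is nonzero, then [v] is a multiple of [x], hence already in the domain. *)
  - move=> w [a [x [/= xw]]]; have [->|a0] := eqVneq a 0.
      by rewrite scale0r add0r => x0; apply: Hfun; rewrite x0.
    move/esym/eqP; rewrite addrC addr_eq0 => /eqP xE; case: nHv.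
    exists (- a^-1 *: w + 0).
    have := Hlin (- a^-1) _ _ _ _ xw H0.
    by rewrite xE scaleNr scalerN opprK scalerA mulVf // scale1r !addr0.
  - by move=> u w [a [x [/= xw _]]]; exact: HC xw.
have [f fH] := choice Htot.
have Huniq v w w' : H (v, w) -> H (v, w') -> w = w'.
  move=> vw vw'; apply/eqP; rewrite -subr_eq0; apply/eqP; apply: Hfun.
  have := Hlin (-1) _ _ _ _ vw' vw.
  by rewrite !scaleN1r addNr addrC.
have flin : linear f.
  by move=> c u v; apply: Huniq (fH _) _; exact: Hlin.
pose fl := HB.pack_for {linear V -> W} f (GRing.isLinear.Build F V W *:%R f flin).
exists fl; split=> [v w Gvw|v]; last exact: HC (fH v).
by apply: Huniq (fH v) _; right.
Qed.

End LinearExtension.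

(** * Words *)

Section LinearMaps.
Variable F : fieldType.

Lemma linear_comp (U V W : lmodType F) (g : V -> W) (f : U -> V) :
  linear g -> linear f -> linear (fun x => g (f x)).
Proof. by move=> gL fL c x y; rewrite /= fL gL. Qed.

Lemma linear_comb (U V : lmodType F) (d : F) (f g : U -> V) :
  linear f -> linear g -> linear (fun x => d *: f x + g x).
Proof.
move=> fL gL c x y /=.
by rewrite fL gL !scalerDr !scalerA mulrC addrACA.
Qed.

Definition bilinear2 (U V W : lmodType F) (f : U -> V -> W) :=
  (forall w, linear (f^~ w)) /\ (forall x, linear (f x)).

(* Tensor powers of E, seen through the universal property of E (x) E^{(x) n} *)
Record word_tower (E : lmodType F) := WordTower {
  wt_space :> nat -> lmodType F;
  wt_nil : wt_space 0;
  wt_cons : forall n, E -> wt_space n -> wt_space n.+1;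
  wt_lift : forall n (P : lmodType F),
    (E -> wt_space n -> P) -> wt_space n.+1 -> P;
  wt_cons_bilinear : forall n, bilinear2 (@wt_cons n);
  wt_lift_linear : forall n P f, bilinear2 f -> linear (@wt_lift n P f);
  wt_liftE : forall n P f, bilinear2 f ->
    forall x w, @wt_lift n P f (wt_cons x w) = f x w;
  wt_nil_ind : forall Q : wt_space 0 -> Prop, Q 0 ->
    (forall c (x y : wt_space 0), Q x -> Q y -> Q (c *: x + y)) ->
    Q wt_nil -> forall x, Q x;
  wt_cons_ind : forall n (Q : wt_space n.+1 -> Prop), Q 0 ->
    (forall c (x y : wt_space n.+1), Q x -> Q y -> Q (c *: x + y)) ->
    (forall x w, Q (wt_cons x w)) -> forall x, Q x
}.

End LinearMaps.

Section Tuples.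
Variable M : nmodType.

(** Letters are indexed by all of [nat], those from [n] on being ignored, so that shifting a word
    needs no cast between ordinal types. *)
Definition nat_tuple n (x : nat -> M) : {ffun 'I_n -> M} := [ffun j : 'I_n => x j].

Lemma nat_tupleP n (a : {ffun 'I_n -> M}) : exists x, a = nat_tuple n x.
Proof.
exists (fun k => if insub k is Some j then a j else 0).
by apply/ffunP => j; rewrite ffunE valK.
Qed.

Lemma eq_nat_tuple n (x y : nat -> M) : (forall k, (k < n)%N -> x k = y k) ->
  nat_tuple n x = nat_tuple n y.
Proof. by move=> xy; apply/ffunP => j; rewrite !ffunE xy. Qed.

Definition cons_seq (x0 : M) (x : nat -> M) k := if k is k'.+1 then x k' else x0.

Definition cons_tuple n x0 (a : {ffun 'I_n -> M}) : {ffun 'I_n.+1 -> M} :=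
  [ffun j => oapp a x0 (unlift ord0 j)].

Definition behead_tuple n (a : {ffun 'I_n.+1 -> M}) : {ffun 'I_n -> M} :=
  [ffun j => a (lift ord0 j)].

Lemma cons_nat_tuple n x0 x :
  cons_tuple x0 (nat_tuple n x) = nat_tuple n.+1 (cons_seq x0 x).
Proof. by apply/ffunP => j; rewrite !ffunE; case: unliftP => [i|] -> //=;
  rewrite ffunE. Qed.

Lemma cons_behead n (a : {ffun 'I_n.+1 -> M}) :
  cons_tuple (a ord0) (behead_tuple a) = a.
Proof. by apply/ffunP => j; rewrite !ffunE; case: unliftP => [i|] -> //=;
  rewrite ffunE. Qed.

End Tuples.

Section Words.
Variables (F : fieldType) (E : lmodType F).

Lemma upd_cons0 n x0 y (a : {ffun 'I_n -> E}) :
  upd (cons_tuple x0 a) ord0 y = cons_tuple y a.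
Proof.
apply/ffunP => j; rewrite !ffunE; case: unliftP => [i|] -> //=.
Qed.

Lemma upd_cons n x0 y i (a : {ffun 'I_n -> E}) :
  cons_tuple x0 (upd a i y) = upd (cons_tuple x0 a) (lift ord0 i) y.
Proof.
apply/ffunP => j; rewrite !ffunE; case: unliftP => [k|] -> //=.
by rewrite !ffunE (inj_eq lift_inj).
Qed.

Definition consT n x0 : tpow E n -> tpow E n.+1 :=
  tlift (fun a => tens (cons_tuple x0 a)).

Fact cons_multilinear n x0 : multilinear (fun a => tens (@cons_tuple E n x0 a)).
Proof. by move=> a i c x y; rewrite !upd_cons tens_multilinear. Qed.

Fact consT_linear n x0 : linear (@consT n x0).
Proof. by apply: tlift_linear; exact: cons_multilinear. Qed.

Lemma consT_tens n x0 (a : {ffun 'I_n -> E}) : consT x0 (tens a) = tens (cons_tuple x0 a).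
Proof. by rewrite /consT tlift_tens //; exact: cons_multilinear. Qed.

Lemma tens_cons n (a : {ffun 'I_n.+1 -> E}) :
  tens a = consT (a ord0) (tens (behead_tuple a)).
Proof. by rewrite consT_tens cons_behead. Qed.

(** With [Q] viewed as a submodule, the quotient map by it kills the elementary tensors, hence is
    zero. *)
Lemma tpow_ind n (Q : tpow E n -> Prop) : Q 0 ->
  (forall c (x y : tpow E n), Q x -> Q y -> Q (c *: x + y)) -> (forall a, Q (tens a)) ->
  forall x, Q x.
Proof.
move=> Q0 Qlin Qt x; pose S := Submodule Q0 Qlin.
have /lpiE : lpi S x = lpi S 0; last by rewrite subr0.
rewrite raddf0; apply: (@tpow_ext F E n _ (lpi S) \0) => a.
by apply: etrans (raddf0 (lpi S)); apply/lpiE; rewrite subr0; exact: Qt.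
Qed.

Lemma tpow_eq n (P : lmodType F) (g h : tpow E n -> P) : linear g -> linear h ->
  (forall a, g (tens a) = h (tens a)) -> g =1 h.
Proof.
move=> gL hL gh.
pose gl := HB.pack_for {linear tpow E n ->
  P} g (GRing.isLinear.Build F (tpow E n) P *:%R g gL).
pose hl := HB.pack_for {linear tpow E n ->
  P} h (GRing.isLinear.Build F (tpow E n) P *:%R h hL).
exact: (@tpow_ext F E n P gl hl).
Qed.

Lemma consT_linearl n (w : tpow E n) : linear (fun x => consT x w).
Proof.
move=> c x y.
apply: (@tpow_eq n _ (consT (c *: x + y)) (fun w => c *: consT x w + consT y w)).
- exact: consT_linear.
- by apply: linear_comb; exact: consT_linear.
- move=> a; rewrite !consT_tens; have := tens_multilinear (cons_tuple x a) ord0 c x y.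
  by rewrite !upd_cons0.
Qed.

Definition clift n (P : lmodType F) (f : E -> tpow E n -> P) : tpow E n.+1 -> P :=
  tlift (fun a => f (a ord0) (tens (behead_tuple a))).

Section Clift.
Variables (n : nat) (P : lmodType F) (f : E -> tpow E n -> P).
Hypothesis fL : bilinear2 f.

Fact clift_multilinear :
  multilinear (fun a : {ffun 'I_n.+1 -> E} => f (a ord0) (tens (behead_tuple a))).
Proof.
move=> a; rewrite -[a]cons_behead; move: (a ord0) (behead_tuple a) => x0 b.
have E0 : forall z (c : {ffun 'I_n -> E}), cons_tuple z c ord0 = z.
  by move=> z c; rewrite ffunE unlift_none.
have E2 : forall z (c : {ffun 'I_n -> E}), behead_tuple (cons_tuple z c) = c.
  by move=> z c; apply/ffunP => j; rewrite !ffunE liftK.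
move=> i c x y; have [j|] := unliftP ord0 i => ->.
  by rewrite -!upd_cons !E0 !E2 tens_multilinear fL.2.
by rewrite !upd_cons0 !E0 !E2; exact: fL.1.
Qed.

Lemma clift_linear : linear (clift f).
Proof. by apply: tlift_linear; exact: clift_multilinear. Qed.

Lemma cliftE x w : clift f (consT x w) = f x w.
Proof.
apply: (@tpow_eq n _ (fun w => clift f (consT x w))) => [||a].
- by apply: linear_comp; [exact: clift_linear|exact: consT_linear].
- exact: fL.2.
- rewrite consT_tens /clift tlift_tens; last exact: clift_multilinear.
  rewrite ffunE unlift_none /=; congr (f x (tens _)).
  by apply/ffunP => j; rewrite !ffunE liftK.
Qed.

End Clift.

Lemma tpow_cons_ind n (Q : tpow E n.+1 -> Prop) : Q 0 ->
  (forall c (x y : tpow E n.+1), Q x -> Q y -> Q (c *: x + y)) ->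
  (forall x w, Q (consT x w)) -> forall x, Q x.
Proof. by move=> Q0 Ql Qc; apply: tpow_ind => // a; rewrite tens_cons. Qed.

Definition nilT : tpow E 0 := tens (nat_tuple 0 (fun=> 0)).

Lemma tens0E (a : {ffun 'I_0 -> E}) : tens a = nilT.
Proof. by congr tens; apply/ffunP => -[]. Qed.

Lemma tpow_nil_ind (Q : tpow E 0 -> Prop) : Q 0 ->
  (forall c (x y : tpow E 0), Q x -> Q y -> Q (c *: x + y)) ->
  Q nilT -> forall x, Q x.
Proof. by move=> Q0 Ql Qn; apply: tpow_ind => // a; rewrite tens0E. Qed.

Definition tpow_words : word_tower E :=
  @WordTower F E (tpow E) nilT consT clift (fun n => conj (@consT_linearl n)
    (@consT_linear n))
    (fun n P f fL => clift_linear fL) (fun n P f fL => cliftE fL)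
    tpow_nil_ind tpow_cons_ind.

End Words.

Section LinearFacts.
Variable F : fieldType.
Implicit Types U V W : lmodType F.

Lemma lin0 U V (f : U -> V) : linear f -> f 0 = 0.
Proof. by move=> fL; have := fL (-1) 0 0; rewrite !scaleN1r !addNr. Qed.

Lemma linD U V (f : U -> V) : linear f -> {morph f : x y / x + y}.
Proof. by move=> fL x y; have := fL 1 x y; rewrite !scale1r. Qed.

Lemma linZ U V (f : U -> V) : linear f -> forall c, {morph f : x / c *: x}.
Proof. by move=> fL c x; have := fL c x 0; rewrite (lin0 fL) !addr0. Qed.

Lemma linN U V (f : U -> V) : linear f -> {morph f : x / - x}.
Proof. by move=> fL x; rewrite -scaleN1r (linZ fL) scaleN1r. Qed.

Lemma linB U V (f : U -> V) : linear f -> {morph f : x y / x - y}.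
Proof. by move=> fL x y; rewrite (linD fL) (linN fL). Qed.

Lemma lin_sum U V (f : U -> V) (I : Type) (r : seq I) (P : pred I) (g : I -> U) :
  linear f -> f (\sum_(i <- r | P i) g i) = \sum_(i <- r | P i) f (g i).
Proof. by move=> fL; apply: big_morph; [exact: linD|exact: lin0]. Qed.

Lemma linear_id U : linear (fun x : U => x). Proof. by []. Qed.

Lemma linear_zero U V : linear (fun _ : U => 0 : V).
Proof. by move=> c x y; rewrite scaler0 addr0. Qed.

Lemma linear_add U V (f g : U -> V) : linear f -> linear g ->
  linear (fun x => f x + g x).
Proof. by move=> fL gL c x y; rewrite fL gL scalerDr addrACA. Qed.

Lemma linear_scale U V (d : F) (f : U -> V) : linear f -> linear (fun x => d *: f x).
Proof. by move=> fL c x y; rewrite fL scalerDr !scalerA mulrC. Qed.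

Lemma linear_opp U V (f : U -> V) : linear f -> linear (fun x => - f x).
Proof. by move=> fL c x y; rewrite fL opprD scalerN. Qed.

Lemma linear_sum_fun U V (I : Type) (r : seq I) (P : pred I) (f : I -> U -> V) :
  (forall i, linear (f i)) -> linear (fun x => \sum_(i <- r | P i) f i x).
Proof.
move=> fL c x y; rewrite scaler_sumr -big_split; apply: eq_bigr => i _.
by rewrite fL.
Qed.

Lemma linear_iter U (f : U -> U) n : linear f -> linear (iter n f).
Proof. by move=> fL c x y; elim: n => //= n ->; rewrite fL. Qed.

Lemma linear_mull (E : algType F) (a : E) : linear (fun x => a * x).
Proof. by move=> c x y; rewrite mulrDr scalerAr. Qed.

Lemma linear_mulr (E : algType F) (a : E) : linear (fun x => x * a).
Proof. by move=> c x y; rewrite mulrDl scalerAl. Qed.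

End LinearFacts.

(** * Elementary words, appending a letter, rotation *)

Section WordsLemmas.
Variables (F : fieldType) (E : lmodType F) (T : word_tower E).
Local Notation cns := (@wt_cons F E T _).
Local Notation nil := (wt_nil T).

Lemma cnsL n (x : E) : linear (cns x : T n -> T n.+1).
Proof. exact: (wt_cons_bilinear T n).2. Qed.

Lemma cnsl n (w : T n) : linear (fun x => cns x w).
Proof. exact: (wt_cons_bilinear T n).1. Qed.

Lemma cons_eq n (P : lmodType F) (g h : T n.+1 -> P) : linear g -> linear h ->
  (forall x w, g (cns x w) = h (cns x w)) -> g =1 h.
Proof.
move=> gL hL gh; apply: wt_cons_ind => // [|c x y gx gy].
  by rewrite (lin0 gL) (lin0 hL).
by rewrite gL hL gx gy.
Qed.

Lemma lift_linearl n (U P : lmodType F) (f : U -> E -> T n -> P) :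
  (forall a, bilinear2 (f a)) -> (forall x w, linear (fun a => f a x w)) ->
  forall v, linear (fun a => wt_lift (f a) v).
Proof.
move=> f2 fa v c a b; move: v; apply: cons_eq => [||x w].
- exact: (wt_lift_linear (f2 _)).
- apply: linear_add; last exact: (wt_lift_linear (f2 _)).
  by apply: linear_scale; exact: (wt_lift_linear (f2 _)).
- by rewrite !wt_liftE //; exact: fa.
Qed.

Fixpoint word n (x : nat -> E) : T n :=
  if n is n'.+1 then cns (x 0%N) (word n' (fun k => x k.+1)) else nil.

Lemma eq_word n x y : (forall k, (k < n)%N -> x k = y k) -> word n x = word n y.
Proof.
elim: n x y => //= n IH x y xy; rewrite xy //; congr cns.
by apply: IH => k kn; apply: xy.
Qed.

Lemma word_ind n (Q : T n -> Prop) : Q 0 ->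
  (forall c (x y : T n), Q x -> Q y -> Q (c *: x + y)) ->
  (forall x, Q (word n x)) -> forall v, Q v.
Proof.
elim: n Q => [|n IH] Q Q0 Ql Qw.
  by apply: wt_nil_ind => //; exact: (Qw (fun=> 0)).
apply: wt_cons_ind => // x; apply: IH => [|c v w Qv Qw'|y].
- by rewrite (lin0 (@cnsL _ _)).
- by rewrite cnsL; exact: Ql.
- exact: (Qw (cons_seq x y)).
Qed.

Lemma word_eq n (P : lmodType F) (g h : T n -> P) : linear g -> linear h ->
  (forall x, g (word n x) = h (word n x)) -> g =1 h.
Proof.
move=> gL hL gh; apply: word_ind => // [|c x y gx gy].
  by rewrite (lin0 gL) (lin0 hL).
by rewrite gL hL gx gy.
Qed.

Fixpoint snoc n (z : E) : T n -> T n.+1 :=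
  match n return T n -> T n.+1 with
  | 0 => fun w => cns z w
  | n'.+1 => wt_lift (fun x w => cns x (snoc z w))
  end.

Fact snoc_bilinear n : bilinear2 (@snoc n).
Proof.
elim: n => [|n IH]; first exact: wt_cons_bilinear.
have b2 z : bilinear2 (fun x w => cns x (@snoc n z w)).
  by split=> [w c x y|x c u v]; rewrite ?(cnsl (snoc z w)) // IH.2 cnsL.
split=> [w|z]; last exact: (wt_lift_linear (b2 _)).
by apply: lift_linearl => // x u; apply: (linear_comp (@cnsL _ x)); exact: IH.1.
Qed.

Lemma snocL n z : linear (@snoc n z).
Proof. exact: (snoc_bilinear n).2. Qed.

Lemma snoc_nil z : snoc z nil = cns z nil. Proof. by []. Qed.

Lemma snoc_cons n x z (w : T n) : snoc z (cns x w) = cns x (snoc z w).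
Proof.
rewrite /= wt_liftE //; split=> [u c y y'|y c u v].
  by rewrite (cnsl (snoc z u)).
by rewrite snocL cnsL.
Qed.

Lemma snoc_word n z x :
  snoc z (word n x) = word n.+1 (fun k => if k == n then z else x k).
Proof.
elim: n x => [//|n IH] x; rewrite snoc_cons IH /=; congr cns.
Qed.

Lemma word_snoc n x : word n.+1 x = snoc (x n) (word n x).
Proof. by rewrite snoc_word; apply: eq_word => k _; case: eqP => [->|]. Qed.

Lemma snoc_eq n (P : lmodType F) (g h : T n.+1 -> P) : linear g -> linear h ->
  (forall z w, g (snoc z w) = h (snoc z w)) -> g =1 h.
Proof. by move=> gL hL gh; apply: word_eq => // x; rewrite word_snoc. Qed.

(** The unsigned cyclic operator, moving the last letter to the front. Only the first letter is
    accessible through [wt_lift], so the tail is rotated first and [x] is put back behind its new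
    head. *)
Fixpoint wrot n : T n.+1 -> T n.+1 :=
  match n return T n.+1 -> T n.+1 with
  | 0 => id
  | n'.+1 => wt_lift (fun x w => wt_lift (fun z u => cns z (cns x u)) (wrot w))
  end.

Fact wrot_aux n x : bilinear2 (fun z (u : T n) => cns z (cns x u)).
Proof. by split=> [u|z] c y y'; rewrite ?cnsL // (cnsl (cns x u)). Qed.

Fact wrot_bilinear n : linear (@wrot n) ->
  bilinear2 (fun x (w : T n.+1) => wt_lift (fun z u => cns z (cns x u)) (wrot w)).
Proof.
move=> rL; split=> [w|x c u v].
  apply: lift_linearl => [a|y u c a a']; first exact: wrot_aux.
  by rewrite (cnsl u) cnsL.
by rewrite rL wt_lift_linear //; exact: wrot_aux.
Qed.

Lemma wrotL n : linear (@wrot n).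
Proof. by elim: n => // n IH; apply: wt_lift_linear; exact: wrot_bilinear. Qed.

Lemma wrot_snoc n z (w : T n) : wrot (snoc z w) = cns z w.
Proof.
elim: n z w => [|n IH] z; first by [].
apply: cons_eq => [||x w].
- by apply: linear_comp; [exact: wrotL|exact: snocL].
- exact: cnsL.
rewrite snoc_cons /= wt_liftE; last exact: wrot_bilinear (@wrotL n).
by rewrite IH wt_liftE //; exact: wrot_aux.
Qed.

Lemma wrot_word n x :
  wrot (word n.+1 x) = word n.+1 (fun k => if k is k'.+1 then x k' else x n).
Proof. by rewrite word_snoc wrot_snoc. Qed.

(** One rotation lowers the indices by 1, that is, adds [n] modulo [n.+1]. *)
Lemma iter_wrot_word n m x :
  iter m (@wrot n) (word n.+1 x) = word n.+1 (fun k => x ((k + m * n) %% n.+1)%N).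
Proof.
elim: m => [|m IH].
  by apply: eq_word => k kn; rewrite mul0n addn0 modn_small.
rewrite iterS IH wrot_word; apply: eq_word => -[|k] kn; congr x.
have -> : (k.+1 + m.+1 * n = n.+1 + (k + m * n))%N by rewrite mulSn; lia.
by rewrite modnDl.
Qed.

Lemma iter_wrot n : iter n.+1 (@wrot n) =1 id.
Proof.
apply: word_eq => [||x]; [exact: linear_iter (@wrotL n)|exact: linear_id|].
by rewrite iter_wrot_word; apply: eq_word => k kn; rewrite addnC mulnC modnMDl modn_small.
Qed.

End WordsLemmas.

Arguments snoc : simpl never.
Arguments wrot : simpl never.

(** * Cyclic identities *)

Section CyclicWords.
Variables (F : fieldType) (E : algType F) (T : word_tower E).
Local Notation cns := (@wt_cons F E T _).
Local Notation nil := (wt_nil T).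
Local Notation word := (word T).

Definition mul_head n (a : E) : T n.+1 -> T n.+1 :=
  wt_lift (fun x w => cns (a * x) w).

Fact mul_head_aux n a : bilinear2 (fun x (w : T n) => cns (a * x) w).
Proof.
split=> [w|x]; last exact: cnsL.
exact: (linear_comp (cnsl w) (linear_mull a)).
Qed.

Lemma mul_head_bilinear n : bilinear2 (@mul_head n).
Proof.
split=> [w|a]; last exact: (wt_lift_linear (@mul_head_aux n a)).
apply: (lift_linearl (@mul_head_aux n)) => x u.
exact: (linear_comp (cnsl u) (linear_mulr x)).
Qed.

Lemma mul_headL n a : linear (@mul_head n a).
Proof. exact: (mul_head_bilinear n).2. Qed.

Lemma mul_headl n (w : T n.+1) : linear (fun a => mul_head a w).
Proof. exact: (mul_head_bilinear n).1. Qed.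

Lemma mul_head_cons n a x (w : T n) : mul_head a (cns x w) = cns (a * x) w.
Proof. by rewrite /mul_head wt_liftE //; exact: mul_head_aux. Qed.

Lemma mul_headM n a a' (w : T n.+1) : mul_head a (mul_head a' w) = mul_head (a * a') w.
Proof.
move: w; apply: cons_eq => [||x w]; last by rewrite !mul_head_cons mulrA.
  by apply: linear_comp; exact: mul_headL.
exact: mul_headL.
Qed.

Definition wface0 n : T n.+2 -> T n.+1 := wt_lift (@mul_head n).

Lemma wface0L n : linear (@wface0 n).
Proof. exact: (wt_lift_linear (mul_head_bilinear n)). Qed.

Lemma wface0_cons n x (w : T n.+1) : wface0 (cns x w) = mul_head x w.
Proof. by rewrite /wface0 wt_liftE //; exact: mul_head_bilinear. Qed.

(** The differential b'. The recursion on the first letter replaces the alternating sum of faces,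
    recovered in [bar_wfaces], so that homotopies defined letter by letter can be checked by
    induction. *)
Fixpoint bar n : T n.+1 -> T n :=
  match n return T n.+1 -> T n with
  | 0 => fun=> 0
  | n'.+1 => wt_lift (fun x w => mul_head x w - cns x (bar w))
  end.

Fact bar_aux n : linear (@bar n) ->
  bilinear2 (fun x (w : T n.+1) => mul_head x w - cns x (bar w)).
Proof.
move=> bL; split=> [w|x].
  by apply: linear_add; [exact: mul_headl|apply: linear_opp; exact: cnsl].
apply: linear_add; first exact: mul_headL.
by apply: linear_opp; exact: (linear_comp (@cnsL _ _ _ _ x)).
Qed.

Lemma barL n : linear (@bar n).
Proof.
elim: n => [|n IH]; first exact: linear_zero.
by apply: wt_lift_linear; exact: bar_aux.
Qed.

Lemma bar_cons n x (w : T n.+1) : bar (cns x w) = mul_head x w - cns x (bar w).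
Proof. by rewrite /= wt_liftE //; apply: bar_aux; exact: barL. Qed.

Arguments bar : simpl never.

Lemma bar_mul_head n a (w : T n.+2) : bar (mul_head a w) = mul_head a (bar w).
Proof.
move: w; apply: cons_eq => [||x w].
- by apply: linear_comp; [exact: barL|exact: mul_headL].
- by apply: linear_comp; [exact: mul_headL|exact: barL].
by rewrite mul_head_cons !bar_cons (linB (@mul_headL _ _)) mul_headM mul_head_cons.
Qed.

Lemma bar_bar n (w : T n.+2) : bar (bar w) = 0.
Proof.
elim: n w => [//|n IH]; apply: cons_eq => [||x w].
- by apply: linear_comp; exact: barL.
- exact: linear_zero.
rewrite bar_cons (linB (@barL _)) bar_mul_head bar_cons IH.
by rewrite (lin0 (@cnsL _ _ _ _ x)) subr0 subrr.
Qed.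

(** The cyclic face of the Hochschild differential: the last letter multiplies the first one from
    the left. *)
Definition wrap n (w : T n.+2) : T n.+1 := wface0 (wrot w).

Lemma wrapL n : linear (@wrap n).
Proof. by apply: linear_comp; [exact: wface0L|exact: wrotL]. Qed.

Lemma wrap_snoc n z (w : T n.+1) : wrap (snoc z w) = mul_head z w.
Proof. by rewrite /wrap wrot_snoc wface0_cons. Qed.

Definition wface_seq i (x : nat -> E) k : E :=
  if (k < i)%N then x k else if k == i then x k * x k.+1 else x k.+1.

(** Face indices above [n] get the value 0. *)
Fixpoint wface n i : T n.+2 -> T n.+1 :=
  match i, n return T n.+2 -> T n.+1 with
  | 0, _ => @wface0 _
  | _.+1, 0 => fun=> 0
  | i'.+1, n'.+1 => wt_lift (fun x w => cns x (wface i' w))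
  end.

Lemma wface_0 n (w : T n.+2) : wface 0 w = wface0 w. Proof. by case: n w. Qed.

Fact wface_aux n i : linear (@wface n i) ->
  bilinear2 (fun x (w : T n.+2) => cns x (wface i w)).
Proof.
move=> fL; split=> [w|x]; first exact: cnsl.
exact: (linear_comp (@cnsL _ _ _ _ x)).
Qed.

Lemma wfaceL n i : linear (@wface n i).
Proof.
elim: i n => [|i IH] [|n]; try exact: wface0L; first exact: linear_zero.
by apply: wt_lift_linear; apply: wface_aux; exact: IH.
Qed.

Lemma wface_word n i x : (i <= n)%N ->
  wface i (word n.+2 x) = word n.+1 (wface_seq i x).
Proof.
have f0 m y : wface0 (word m.+2 y) = word m.+1 (wface_seq 0 y).
  by rewrite [word m.+2 _]/= wface0_cons mul_head_cons.
elim: i n x => [|i IH] [|n] x li //; try exact: f0.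
rewrite [word n.+3 _]/= [LHS]/= wt_liftE; last by apply: wface_aux; exact: wfaceL.
by rewrite -[cns (x 1%N) _]/(word n.+2 (fun k => x k.+1)) IH.
Qed.

Lemma bar_wfaces n (w : T n.+2) : bar w = \sum_(i < n.+1) (-1) ^+ i *: wface i w.
Proof.
elim: n w => [|n IH]; apply: cons_eq => [||x w].
- exact: barL.
- by apply: linear_sum_fun => i; apply: linear_scale; exact: wfaceL.
- rewrite bar_cons [bar w]/bar (lin0 (@cnsL _ _ _ _ x)) subr0 big_ord1 scale1r.
  by rewrite [wface _ _]/= wface0_cons.
- exact: barL.
- by apply: linear_sum_fun => i; apply: linear_scale; exact: wfaceL.
- rewrite bar_cons IH [RHS]big_ord_recl scale1r; congr (_ + _);
  first by rewrite -wface0_cons.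
  rewrite (lin_sum _ _ _ (@cnsL _ _ _ _ x)) -sumrN; apply: eq_bigr => i _.
  rewrite (linZ (@cnsL _ _ _ _ x)) exprS mulN1r scaleNr; congr (- (_ *: _)).
  by rewrite /= wt_liftE //; apply: wface_aux; exact: wfaceL.
Qed.

Lemma bar_word n x :
  bar (word n.+2 x) = \sum_(i < n.+1) (-1) ^+ i *: word n.+1 (wface_seq i x).
Proof.
by rewrite bar_wfaces; apply: eq_bigr => i _; rewrite wface_word // -ltnS ltn_ord.
Qed.

Lemma wrap_word n x : wrap (word n.+2 x) =
  word n.+1 (fun k => if k is 0 then x n.+1 * x 0%N else x k).
Proof.
rewrite /wrap wrot_word [X in wface0 X]/= wface0_cons mul_head_cons.
by rewrite -[LHS]/(word n.+1 (cons_seq _ _)); apply: eq_word => -[|k].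
Qed.

Lemma wface_wrot n i (w : T n.+2) : (i < n)%N -> wface i.+1 (wrot w) = wrot (wface i w).
Proof.
move=> li; move: w; apply: word_eq => [||x].
- by apply: linear_comp; [exact: wfaceL|exact: wrotL].
- by apply: linear_comp; [exact: wrotL|exact: wfaceL].
rewrite wrot_word !wface_word ?(ltnW li) // wrot_word.
apply: eq_word => -[|k] kn; rewrite /wface_seq //=.
by rewrite ltnNge (ltnW li) /= gtn_eqF.
Qed.

Lemma wrap_wrot n (w : T n.+2) : wrap (wrot w) = wrot (wface n w).
Proof.
move: w; apply: word_eq => [||x].
- by apply: linear_comp; [exact: wrapL|exact: wrotL].
- by apply: linear_comp; [exact: wrotL|exact: wfaceL].
rewrite wrot_word wface_word // wrot_word wrap_word.
apply: eq_word => -[|k] kn; rewrite /wface_seq /=; first by rewrite ltnn eqxx.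
by rewrite (_ : (k < n)%N).
Qed.

Lemma wrap_wface n i (w : T n.+3) : (i <= n)%N -> wrap (wface i w) = wface i (wrap w).
Proof.
move=> li; move: w; apply: word_eq => [||x].
- by apply: linear_comp; [exact: wrapL|exact: wfaceL].
- by apply: linear_comp; [exact: wfaceL|exact: wrapL].
rewrite wrap_word !wface_word ?leqW // wrap_word; apply: eq_word => -[|k] kn.
  rewrite /wface_seq /= ltnNge leqW //= gtn_eqF ?ltnS //.
  by case: i li => [|i] _; rewrite /= ?mulrA.
by rewrite /wface_seq; case: ltnP => //; case: eqP.
Qed.

Lemma wrap_wface_last n (w : T n.+3) : wrap (wface n.+1 w) = wrap (wrap w).
Proof.
move: w; apply: word_eq => [||x].
- by apply: linear_comp; [exact: wrapL|exact: wfaceL].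
- by apply: linear_comp; exact: wrapL.
rewrite wface_word // !wrap_word; apply: eq_word => -[|k] kn.
  by rewrite /wface_seq /= ltnn eqxx mulrA.
by rewrite /wface_seq /= ifT.
Qed.

(** The wrap commutes with every face but the last, and following the last face it is the wrap
    applied twice. The sign of that term makes [hoch] square to zero. *)
Lemma wrap_bar n (w : T n.+3) :
  wrap (bar w) = bar (wrap w) + (-1) ^+ n.+1 *: wrap (wrap w).
Proof.
rewrite !bar_wfaces (lin_sum _ _ _ (@wrapL _)) big_ord_recr /=.
rewrite (linZ (@wrapL _)) wrap_wface_last; congr (_ + _).
apply: eq_bigr => i _; rewrite (linZ (@wrapL _)) wrap_wface //.
by rewrite -ltnS ltn_ord.
Qed.

(* degree 0 is given the zero boundary *)
Definition hoch n : T n.+1 -> T n :=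
  match n return T n.+1 -> T n with
  | 0 => fun=> 0
  | n'.+1 => fun w => bar w + (-1) ^+ n'.+1 *: wrap w
  end.

Lemma hochS n (w : T n.+2) : hoch w = bar w + (-1) ^+ n.+1 *: wrap w.
Proof. by []. Qed.

Lemma hochL n : linear (@hoch n).
Proof.
case: n => [|n]; first exact: linear_zero.
by apply: linear_add; [exact: barL|apply: linear_scale; exact: wrapL].
Qed.

Lemma hoch_hoch n (w : T n.+2) : hoch (hoch w) = 0.
Proof.
case: n w => [//|n] w; rewrite !hochS.
rewrite (linD (@barL _)) (linD (@wrapL _)) (linZ (@barL _)) (linZ (@wrapL _)).
rewrite bar_bar wrap_bar add0r (exprS _ n.+1) mulN1r !scaleNr addrK.
exact: addNr.
Qed.

Definition cyc n (w : T n.+1) : T n.+1 := (-1) ^+ n *: wrot w.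

Lemma cycL n : linear (@cyc n).
Proof. by apply: linear_scale; exact: wrotL. Qed.

Definition cnorm n (w : T n.+1) : T n.+1 := \sum_(i < n.+1) iter i (@cyc n) w.

Lemma cnormL n : linear (@cnorm n).
Proof. by apply: linear_sum_fun => i; apply: linear_iter; exact: cycL. Qed.

Lemma iter_cycE n m (w : T n.+1) :
  iter m (@cyc n) w = ((-1) ^+ n) ^+ m *: iter m (@wrot _ _ T n) w.
Proof.
elim: m => [|m IH]; first by rewrite scale1r.
by rewrite !iterS IH /cyc (linZ (@wrotL _ _ _ _)) scalerA exprS.
Qed.

Lemma iter_cyc n (w : T n.+1) : iter n.+1 (@cyc n) w = w.
Proof.
rewrite iter_cycE iter_wrot -exprM -signr_odd oddM /= andbN.
by rewrite scale1r.
Qed.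

Lemma cyc_cnorm n (w : T n.+1) : cyc (cnorm w) = cnorm w.
Proof.
rewrite /cnorm (lin_sum _ _ _ (@cycL _)) [LHS]big_ord_recr /=.
by rewrite [RHS]big_ord_recl /= -iterS iter_cyc addrC.
Qed.

Lemma cnorm_cyc n (w : T n.+1) : cnorm (cyc w) = cnorm w.
Proof.
rewrite -[RHS]cyc_cnorm /cnorm (lin_sum _ _ _ (@cycL _)); apply: eq_bigr => i _.
by rewrite -iterSr.
Qed.

Lemma iter_cyc_cnorm n m (w : T n.+1) : iter m (@cyc n) (cnorm w) = cnorm w.
Proof. by elim: m => //= m ->; rewrite cyc_cnorm. Qed.

Lemma cnorm_iter_cyc n m (w : T n.+1) : cnorm (iter m (@cyc n) w) = cnorm w.
Proof. by elim: m => //= m IH; rewrite cnorm_cyc. Qed.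

(** Rotation carries each face to the next one, the last face to the wrap, and the wrap to the face
    0. So b t and t b' differ by the wrap term only, which cancels the one in b. *)
Lemma hoch_cyc n (w : T n.+2) : hoch (w - cyc w) = bar w - cyc (bar w).
Proof.
have ss k : (-1) ^+ k * (-1) ^+ k = 1 :> F by rewrite -expr2 sqrr_sign.
rewrite (linB (@hochL _)); suff -> : hoch (cyc w) = (-1) ^+ n.+1 *: wrap w + cyc (bar w).
  by rewrite hochS opprD addrA addrK.
rewrite (linZ (@hochL _)) hochS wrap_wrot scalerDr scalerA ss scale1r.
rewrite bar_wfaces big_ord_recl scale1r scalerDr -addrA; congr (_ + _);
  first by rewrite [wface _ _]wface_0.
rewrite bar_wfaces /cyc (lin_sum _ _ _ (@wrotL _ _ _ _)) [in RHS]big_ord_recr /=.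
rewrite (linZ (@wrotL _ _ _ _)) scalerDr scalerA ss.
rewrite scale1r; congr (_ + _); rewrite !scaler_sumr; apply: eq_bigr => i _.
rewrite wface_wrot // (linZ (@wrotL _ _ _ _)) !scalerA.
by rewrite /bump /= add1n !exprS; congr (_ *: _); rewrite !mulN1r mulrNN.
Qed.

Lemma wface_cyc n i (w : T n.+2) : (i < n)%N -> wface i.+1 (cyc w) = - cyc (wface i w).
Proof.
move=> li; rewrite (linZ (@wfaceL _ _)) wface_wrot // /cyc exprS mulN1r.
by rewrite scaleNr.
Qed.

Lemma wface_iter_cyc n i (w : T n.+2) : (i <= n)%N ->
  (-1) ^+ i *: wface i (iter i (@cyc _) w) = iter i (@cyc _) (wface0 w).
Proof.
elim: i => [|i IH] li; first by rewrite scale1r wface_0.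
rewrite [iter i.+1 _ w]iterS wface_cyc // exprS mulN1r scaleNr scalerN opprK.
by rewrite -(linZ (@cycL _)) IH ?(ltnW li).
Qed.

(** Both sides equal N d_0 N applied to [w], where N is [cnorm], t is [cyc] and d_0 is [wface0]: the
    i-th signed face composed with t^i is t^i d_0, and N absorbs powers of t on either side. *)
Lemma bar_cnorm n (w : T n.+2) : bar (cnorm w) = cnorm (hoch w).
Proof.
transitivity (cnorm (wface0 (cnorm w))).
  rewrite bar_wfaces; apply: eq_bigr => i _.
  by rewrite -{1}(iter_cyc_cnorm i) wface_iter_cyc // -ltnS ltn_ord.
(* As t^(n+2) = 1 here, the i-th signed face becomes d_0 t^(n+2-i) under N. *)
have dE i : (i <= n)%N ->
    cnorm ((-1) ^+ i *: wface i w) = cnorm (wface0 (iter (n.+2 - i) (@cyc _) w)).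
  move=> li; have := wface_iter_cyc (iter (n.+2 - i) (@cyc _) w) li.
  rewrite -iterD subnKC; last by rewrite ltnW // ltnW.
  by rewrite iter_cyc => ->; rewrite cnorm_iter_cyc.
rewrite {2}/cnorm (lin_sum _ _ _ (@wface0L _)) (lin_sum _ _ _ (@cnormL _)).
rewrite hochS (linD (@cnormL _)) bar_wfaces (lin_sum _ _ _ (@cnormL _)).
rewrite (eq_bigr (fun i : 'I_n.+1 => cnorm (wface0 (iter (n.+2 - i) (@cyc _) w))));
  last first.
  by move=> i _; rewrite dE // -ltnS ltn_ord.
rewrite [RHS]addrC.
(* The wrap supplies the exponent 1, which the faces, with exponents 2 to n+2, leave out. *)
have -> : (-1) ^+ n.+1 *: wrap w = wface0 (cyc w) by rewrite -(linZ (@wface0L _)).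
rewrite [LHS]big_ord_recl [in LHS]big_ord_recl /=.
rewrite [X in _ = _ + X]big_ord_recl.
rewrite (_ : iter (n.+2 - (ord0 : 'I_n.+1)) (@cyc _) w = w); last exact: iter_cyc.
rewrite [RHS]addrCA; congr (_ + (_ + _)).
rewrite [RHS](reindex_inj rev_ord_inj) /=; apply: eq_bigr => i _.
rewrite -[cyc (cyc _)]/(iter i.+2 (@cyc n.+1) w) (_ : (n.+2 - _ = i.+2)%N) //.
by have := ltn_ord i; rewrite /bump; lia.
Qed.

End CyclicWords.

Arguments bar : simpl never.
Arguments wface : simpl never.
Arguments hoch : simpl never.

(** * Excision *)

Section Spans.
Variable F : fieldType.
Implicit Types V W : lmodType F.

Section SubmoduleFacts.
Variables (V : lmodType F) (S : submodule V).

Lemma submodD x y : S x -> S y -> S (x + y).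
Proof. by move=> Sx Sy; rewrite -[x]scale1r; exact: submodP. Qed.

Lemma submodZ c x : S x -> S (c *: x).
Proof. by move=> Sx; rewrite -[_ *: _]addr0; apply: submodP => //; exact: submod0. Qed.

Lemma submodN x : S x -> S (- x).
Proof. by rewrite -scaleN1r; exact: submodZ. Qed.

Lemma submodB x y : S x -> S y -> S (x - y).
Proof. by move=> Sx /submodN; exact: submodD. Qed.

Lemma submod_sum (I : Type) (r : seq I) (P : pred I) (f : I -> V) :
  (forall i, P i -> S (f i)) -> S (\sum_(i <- r | P i) f i).
Proof. by move=> Sf; elim/big_rec: _ => [|i x Pi Sx];
  [exact: submod0|apply: submodD => //; exact: Sf]. Qed.

End SubmoduleFacts.

Definition lspan_set V (X : set V) : set V :=
  [set v | forall S : submodule V, (forall x, X x -> S x) -> S v].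

Fact lspan0 V (X : set V) : lspan_set X 0.
Proof. by move=> S _; exact: submod0. Qed.

Fact lspanP V (X : set V) c x y :
  lspan_set X x -> lspan_set X y -> lspan_set X (c *: x + y).
Proof. by move=> Xx Xy S XS; apply: submodP; [exact: Xx|exact: Xy]. Qed.

Definition lspan V (X : set V) := Submodule (@lspan0 V X) (@lspanP V X).

Lemma lspan_gen V (X : set V) x : X x -> lspan X x.
Proof. by move=> Xx S; exact. Qed.

Lemma lspan_map V W (X : set V) (S : submodule W) (f : V -> W) : linear f ->
  (forall x, X x -> S (f x)) -> forall v, lspan X v -> S (f v).
Proof.
move=> fL fS v; have S0 : S (f 0) by rewrite (lin0 fL); exact: submod0.
have SP c x y : S (f x) -> S (f y) -> S (f (c *: x + y)).
  by rewrite fL; exact: submodP.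
by move/(_ (Submodule S0 SP)); exact.
Qed.

Definition addsub_set V (S S' : submodule V) : set V :=
  [set v | exists x y, [/\ S x, S' y & v = x + y]].

Fact addsub0 V (S S' : submodule V) : addsub_set S S' 0.
Proof. by exists 0, 0; rewrite addr0; split=> //; exact: submod0. Qed.

Fact addsubP V (S S' : submodule V) c x y :
  addsub_set S S' x -> addsub_set S S' y -> addsub_set S S' (c *: x + y).
Proof.
move=> [a [b [Sa Sb ->]]] [a' [b' [Sa' Sb' ->]]].
exists (c *: a + a'), (c *: b + b').
by rewrite scalerDr addrACA; split=> //; exact: submodP.
Qed.

Definition addsub V (S S' : submodule V) :=
  Submodule (@addsub0 V S S') (@addsubP V S S').

End Spans.

(** * Words over a subset and words meeting an ideal *)

Section WordSpans.
Variables (F : fieldType) (E : algType F) (T : word_tower E).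
Local Notation cns := (@wt_cons F E T _).
Local Notation word := (word T).

Definition words_in (P : set E) n : submodule (T n) :=
  lspan [set v | exists x, (forall k, (k < n)%N -> P (x k)) /\ v = word n x].

(** The filtration by the first position of a letter of [I]: zero for [p = 0], spanned by all words
    meeting [I] for [p = n]. *)
Definition words_hit (I : set E) p n : submodule (T n) :=
  lspan [set v | exists x, (exists k, [/\ (k < p)%N, (k < n)%N & I (x k)]) /\ v = word n x].

Lemma words_in_gen (P : set E) n x : (forall k, (k < n)%N -> P (x k)) ->
  words_in P n (word n x).
Proof. by move=> Px; apply: lspan_gen; exists x. Qed.

Lemma words_hit_gen (I : set E) p n k x : (k < p)%N -> (k < n)%N -> I (x k) ->
  words_hit I p n (word n x).
Proof. by move=> kp kn Ik; apply: lspan_gen; exists x; split=> //; exists k. Qed.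

Lemma words_in_ind (P : set E) n (W : lmodType F) (S : submodule W) (f : T n -> W) :
  linear f -> (forall x, (forall k, (k < n)%N -> P (x k)) -> S (f (word n x))) ->
  forall v, words_in P n v -> S (f v).
Proof. by move=> fL fS; apply: lspan_map => // _ [x [Px ->]]; exact: fS. Qed.

Lemma words_hit_ind (I : set E) p n (W : lmodType F) (S : submodule W) (f : T n -> W) :
  linear f ->
  (forall x k, (k < p)%N -> (k < n)%N -> I (x k) -> S (f (word n x))) ->
  forall v, words_hit I p n v -> S (f v).
Proof.
by move=> fL fS; apply: lspan_map => // _ [x [[k [kp kn Ik]] ->]]; exact: fS Ik.
Qed.

Lemma word_all n (W : lmodType F) (S : submodule W) (f : T n -> W) :
  linear f -> (forall x, S (f (word n x))) -> forall v, S (f v).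
Proof.
move=> fL fS; apply: word_ind => // [|c x y Sx Sy].
  by rewrite (lin0 fL); exact: submod0.
by rewrite fL; exact: submodP.
Qed.

Lemma words_in_cons (P : set E) n a (w : T n) : P a -> words_in P n w ->
  words_in P n.+1 (cns a w).
Proof.
move=> Pa; apply: words_in_ind; first exact: cnsL.
move=> x Px; rewrite -[cns a _]/(word n.+1 (cons_seq a x)).
by apply: words_in_gen => -[|k] // kn; exact: Px.
Qed.

Lemma words_in_nil (P : set E) (w : T 0) : words_in P 0 w.
Proof. by apply: (word_all (f := id)) => // x; exact: words_in_gen. Qed.

Lemma words_hit_cons0 (I : set E) p n a (w : T n) : I a -> words_hit I p.+1 n.+1 (cns a w).
Proof.
move=> Ia; apply: word_all; first exact: cnsL.
move=> x; rewrite -[cns a _]/(word n.+1 (cons_seq a x)).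
exact: (@words_hit_gen _ _ _ 0).
Qed.

Lemma words_hit_consS (I : set E) p n a (w : T n) : words_hit I p n w ->
  words_hit I p.+1 n.+1 (cns a w).
Proof.
apply: words_hit_ind; first exact: cnsL.
move=> x k kp kn Ik; rewrite -[cns a _]/(word n.+1 (cons_seq a x)).
exact: (@words_hit_gen _ _ _ k.+1).
Qed.

Lemma words_hitW (I : set E) p q n (w : T n) : (p <= q)%N -> words_hit I p n w ->
  words_hit I q n w.
Proof.
move=> pq; apply: (words_hit_ind (f := id)) => // x k kp kn.
by apply: words_hit_gen => //; exact: leq_trans pq.
Qed.

(** When all letters are multiplied out, one term has its letters in [P] and every other term has a
    letter in [I]. *)
Lemma words_in_word_expand (P P' I : set E) n (v : T n) :
  (forall x, P' x -> exists y z, [/\ P y, I z & x = y + z]) ->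
  words_in P' n v -> addsub (words_in P n) (words_hit I n n) v.
Proof.
move=> P'E; apply: (words_in_ind (f := id)) => // x; elim: n x {v} => [|n IH] x Px.
  by exists (word 0 x), 0; rewrite addr0; split=> //; [exact: words_in_gen|exact: submod0].
have [y [z [Py Iz xE]]] := P'E _ (Px 0%N isT).
have [u [w [uP wI wE]]] := IH (fun k => x k.+1) (fun k kn => Px k.+1 kn).
exists (cns y u), (cns y w + cns z (u + w)).
rewrite [word _ _]/= wE xE (linD (cnsl _)) (linD (@cnsL _ _ _ _ y)) addrA; split=> //.
  exact: words_in_cons.
apply: submodD; first exact: words_hit_consS.
exact: words_hit_cons0.
Qed.

Section Ideal.
Variable I : set E.
Hypothesis Il : forall a x, I x -> I (a * x).
Hypothesis Ir : forall x a, I x -> I (x * a).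

Lemma mul_head_words_hit p n a (w : T n.+1) : words_hit I p n.+1 w ->
  words_hit I p n.+1 (mul_head a w).
Proof.
apply: words_hit_ind; first exact: mul_headL.
move=> x k kp kn Ik; rewrite [word _ _]/= mul_head_cons.
rewrite -[cns _ _]/(word n.+1 (cons_seq (a * x 0%N) (fun k => x k.+1))).
by apply: (@words_hit_gen _ _ _ k) => //; case: k Ik {kp kn} => //= /Il.
Qed.

Lemma bar_words_hit p n (w : T n.+1) : words_hit I p n.+1 w -> words_hit I p n (bar w).
Proof.
apply: words_hit_ind; first exact: barL.
case: n {w} => [|n] x k kp kn Ik; first exact: submod0.
rewrite bar_word; apply: submod_sum => i _; apply: submodZ.
(* A face to the left of position [k] moves the letter of [I] one place to the left, any other face
   keeps its position. *)
have [ik|ki] := ltnP i k.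
  case: k ik kp kn Ik => // k ik kp kn Ik.
  apply: (@words_hit_gen _ _ _ k) => //; first exact: ltnW.
  rewrite /wface_seq ltnNge -ltnS ik /=.
  by case: eqP => // _; exact: Il.
apply: (@words_hit_gen _ _ _ k) => //; first exact: leq_ltn_trans ki _.
rewrite /wface_seq; case: ltnP => // ik; case: eqP => [_|ki']; first exact: Ir.
by case: ki'; apply/eqP; rewrite eqn_leq ki ik.
Qed.

End Ideal.

Section Subalgebra.
Variable P : set E.
Hypothesis PM : forall x y, P x -> P y -> P (x * y).

Lemma bar_words_in n (w : T n.+1) : words_in P n.+1 w -> words_in P n (bar w).
Proof.
apply: words_in_ind; first exact: barL.
case: n {w} => [|n] x Px; first exact: submod0.
rewrite bar_word; apply: submod_sum => i _; apply: submodZ; apply: words_in_gen => k kn.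
have Pk := Px k (leqW kn); have Pk1 := Px k.+1 kn.
by rewrite /wface_seq; case: ltnP => // _; case: eqP => // _; exact: PM.
Qed.

Lemma wrot_words_in n (w : T n.+1) : words_in P n.+1 w -> words_in P n.+1 (wrot w).
Proof.
apply: words_in_ind; first exact: wrotL.
move=> x Px; rewrite wrot_word; apply: words_in_gen => -[|k] kn; first exact: Px.
by apply: Px; exact: ltnW.
Qed.

Lemma cyc_words_in n (w : T n.+1) : words_in P n.+1 w -> words_in P n.+1 (cyc w).
Proof. by move=> wP; apply: submodZ; exact: wrot_words_in. Qed.

Lemma cnorm_words_in n (w : T n.+1) : words_in P n.+1 w -> words_in P n.+1 (cnorm w).
Proof.
move=> wP; apply: submod_sum => i _; elim: (i : nat) => //= m; exact: cyc_words_in.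
Qed.

Lemma wrap_words_in n (w : T n.+2) : words_in P n.+2 w -> words_in P n.+1 (wrap w).
Proof.
apply: words_in_ind; first exact: wrapL.
move=> x Px; rewrite wrap_word; apply: words_in_gen => -[|k] kn.
  by apply: PM; exact: Px.
by apply: Px; exact: ltnW.
Qed.

Lemma hoch_words_in n (w : T n.+1) : words_in P n.+1 w -> words_in P n (hoch w).
Proof.
case: n w => [|n] w wP; first exact: submod0.
rewrite hochS; apply: submodD; first exact: bar_words_in.
by apply: submodZ; exact: wrap_words_in.
Qed.

End Subalgebra.

End WordSpans.

(** * Contracting homotopies for excision *)

Section Excision.
Variables (F : fieldType) (E : algType F) (T : word_tower E).
Local Notation cns := (@wt_cons F E T _).
Local Notation word := (word T).
Variables (N : nat) (l r : 'I_N -> E) (proj : {linear E -> E}) (I P : set E).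
Hypothesis Il : forall a x, I x -> I (a * x).
Hypothesis Ir : forall x a, I x -> I (x * a).
Hypothesis PM : forall x y, P x -> P y -> P (x * y).
Hypothesis lI : forall i, I (l i).
Hypothesis lP : forall i, P (l i).
Hypothesis rI : forall i, I (r i).
Hypothesis lr1 : forall x, I x -> \sum_i l i * (r i * x) = x.
Hypothesis IPP : forall x y, I x -> I y -> P y -> P (x * y).
Hypothesis projI : forall x, I x -> proj x = x.
Hypothesis projP : forall x, P x -> I (proj x) /\ P (proj x).

Local Notation inP := (words_in T P).
Local Notation words_hit := (words_hit T I).

(* a contracting homotopy modulo the words with a letter in I before position p *)
Fixpoint insert p n {struct n} : T n -> T n.+1 :=
  match n return T n -> T n.+1 with
  | 0 => fun=> 0
  | n'.+1 => if p is p'.+1 then wt_lift (fun x w => - cns x (insert p' w))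
             else wt_lift (fun x w => \sum_i cns (l i) (cns (r i * proj x) w))
  end.

Fact insert0_aux n :
  bilinear2 (fun x (w : T n) => \sum_i cns (l i) (cns (r i * proj x) w)).
Proof.
split=> [w|x]; apply: linear_sum_fun => i.
  apply: (linear_comp (@cnsL _ _ _ _ (l i))); apply: (linear_comp (cnsl w)).
  by apply: linear_comp; [exact: linear_mull|exact: linearP].
by apply: (linear_comp (@cnsL _ _ _ _ (l i))); exact: cnsL.
Qed.

Fact insertS_aux p n : linear (@insert p n) ->
  bilinear2 (fun x (w : T n) => - cns x (insert p w)).
Proof.
move=> iL; split=> [w|x]; apply: linear_opp; first exact: cnsl.
exact: (linear_comp (@cnsL _ _ _ _ x)).
Qed.

Lemma insertL p n : linear (@insert p n).
Proof.
elim: n p => [|n IH] [|p]; try exact: linear_zero.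
  by apply: wt_lift_linear; exact: insert0_aux.
by apply: wt_lift_linear; exact: insertS_aux.
Qed.

Lemma insert0_cons n x (w : T n) :
  insert 0 (cns x w) = \sum_i cns (l i) (cns (r i * proj x) w).
Proof. by rewrite /= wt_liftE //; exact: insert0_aux. Qed.

Lemma insertS_cons p n x (w : T n) : insert p.+1 (cns x w) = - cns x (insert p w).
Proof. by rewrite /= wt_liftE //; apply: insertS_aux; exact: insertL. Qed.

Lemma insert_nil p (w : T 0) : insert p w = 0. Proof. by case: p. Qed.

Arguments insert : simpl never.

Lemma insert_words_hit_any p n (w : T n) : words_hit p.+1 n.+1 (insert p w).
Proof.
apply: word_all; first exact: insertL.
elim: n p {w} => [|n IH] p x; first exact: submod0.
case: p => [|p]; last first.
  by rewrite [word _ _]/= insertS_cons; apply: submodN; apply: words_hit_consS; exact: IH.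
rewrite [word _ _]/= insert0_cons; apply: submod_sum => i _.
exact: words_hit_cons0.
Qed.

Lemma insert_words_hit p n (w : T n) : words_hit p n w -> words_hit p n.+1 (insert p w).
Proof.
apply: words_hit_ind; first exact: insertL.
elim: p n {w} => // p IH [|n] // x [|k] kp kn Ik; rewrite [word _ _]/= insertS_cons.
  by apply: submodN; exact: words_hit_cons0.
by apply: submodN; apply: words_hit_consS; exact: (IH _ _ k).
Qed.

(** For a letter x in [P], [proj] x is in both [I] and [P], so its product with r_i remains in [P]
    by [IPP]. *)
Lemma insert_words_in p n (w : T n) : inP n w -> inP n.+1 (insert p w).
Proof.
apply: words_in_ind; first exact: insertL.
elim: n p {w} => [|n IH] p x Px; first exact: submod0.
have Pw : inP n (word n (fun k => x k.+1)).
  by apply: words_in_gen => k kn; exact: (Px k.+1 kn).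
case: p => [|p]; rewrite [word _ _]/=.
  rewrite insert0_cons; apply: submod_sum => i _; apply: words_in_cons => //.
  by apply: words_in_cons => //; have [Ix Px0] := projP (Px 0%N isT); exact: IPP.
rewrite insertS_cons; apply: submodN; apply: words_in_cons; first exact: (Px 0%N).
by apply: IH => k kn; exact: (Px k.+1).
Qed.

Lemma insert0_mul_head n a (w : T n.+1) : I a ->
  insert 0 (mul_head a w) = \sum_i cns (l i) (mul_head (r i * a) w).
Proof.
move=> Ia; move: w; apply: cons_eq => [||x w].
- by apply: linear_comp; [exact: insertL|exact: mul_headL].
- apply: linear_sum_fun => i; apply: (linear_comp (@cnsL _ _ _ _ (l i))).
  exact: mul_headL.
rewrite mul_head_cons insert0_cons; apply: eq_bigr => i _.
by rewrite projI ?mul_head_cons ?mulrA //; exact: Ir.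
Qed.

(** For [p = 0] the identity is exact: the sum of l_i r_i acts as 1 on the first letter, and the
    other terms cancel. For larger [p] one passes to the tail; the products with the first letter
    have a letter of [I] one place earlier, hence are allowed as an error. *)
Lemma bar_insert p n (v : T n.+1) : words_hit p.+1 n.+1 v ->
  words_hit p n.+1 (bar (insert p v) + insert p (bar v) - v).
Proof.
apply: (@words_hit_ind _ _ _ I p.+1 _ _ _ (fun v => bar (insert p v) + insert p (bar v) -
  v)).
  apply: linear_add; last by apply: linear_opp; exact: linear_id.
  apply: linear_add; apply: linear_comp; try exact: insertL; exact: barL.
elim: p n {v} => [|p IH] n x k kp kn Ik.
  case: k kp kn Ik => // _ _ Ix; rewrite (_ : _ - _ = 0); first exact: submod0.
  apply/eqP; rewrite subr_eq0; apply/eqP.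
  rewrite [word _ _]/=; move: (word n _) => w; move: (x 0%N) Ix => {}x Ix.
  rewrite insert0_cons (lin_sum _ _ _ (@barL _ _ _ _)) projI //.
  rewrite (eq_bigr (fun i => cns (l i * (r i * x)) w
    - cns (l i) (bar (cns (r i * x) w)))); last first.
    by move=> i _; rewrite bar_cons mul_head_cons.
  rewrite big_split /= -(lin_sum _ _ _ (cnsl w)) lr1 // sumrN -[RHS]addr0 -addrA.
  congr (_ + _); case: n w => [|n] w.
    rewrite /bar (lin0 (@insertL _ _)) addr0 big1 ?oppr0 // => i _.
    by rewrite (lin0 (@cnsL _ _ _ _ _)).
  rewrite bar_cons (linB (@insertL _ _)) insert0_mul_head // insert0_cons projI //.
  apply/eqP; rewrite addrC subr_eq0 -sumrB; apply/eqP; apply: eq_bigr => i _.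
  by rewrite bar_cons (linB (@cnsL _ _ _ _ _)).
have [Ix|[k' kE]] : I (x 0%N) \/ exists k', k = k'.+1.
- by case: k kp kn Ik => [|k]; [left|right; exists k].
(* A first letter in [I] already puts every term in the target [words_hit p.+1]. *)
- have vI : words_hit p.+1 n.+1 (word n.+1 x) by exact: (@words_hit_gen _ _ _ _ _ _ 0).
  apply: submodB => //; apply: submodD; first by apply: bar_words_hit => //;
    exact: insert_words_hit.
  by apply: insert_words_hit; exact: bar_words_hit.
- subst k.
  case: n kn => // n kn.
  rewrite (_ : word n.+2 x = cns (x 0%N) (word n.+1 (fun k => x k.+1))) //.
  have wI := IH n (fun k => x k.+1) k' kp kn Ik.
  have wT : words_hit p.+1 n.+1 (word n.+1 (fun k => x k.+1)) by exact: words_hit_gen Ik.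
  move: (word n.+1 _) wI wT => w wI wT.
  rewrite insertS_cons (linN (@barL _ _ _ _)) !bar_cons (linB (@insertL _ _)).
  rewrite insertS_cons opprK opprB.
  rewrite [X in _ + X - _]addrC addrACA [_ - cns _ w]addrAC -(linD (@cnsL _ _ _ _ _)).
  rewrite -(linB (@cnsL _ _ _ _ _)); apply: submodD; first exact: words_hit_consS.
  apply: submodD; first by apply: submodN; apply: mul_head_words_hit => //;
    exact: insert_words_hit_any.
  by apply: insert_words_hit; exact: mul_head_words_hit.
Qed.

(** The two sides differ only if the insertion takes place at the appended letter [z]; the last
    letter is then r_i [proj] z, which lies in [I]. *)
Lemma insert_snoc p n z (w : T n) :
  lspan [set v | exists y u, I y /\
    v = snoc y u] (insert p (snoc z w) - snoc z (insert p w)).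
Proof.
apply: (@word_all _ _ _ _ _ _ (fun w => insert p (snoc z w) - snoc z (insert p w))).
  apply: linear_add; last apply: linear_opp; apply: linear_comp.
  - exact: insertL.
  - exact: snocL.
  - exact: snocL.
  - exact: insertL.
elim: n p {w} => [|n IH] p x; rewrite [word _ _]/=.
  rewrite snoc_nil insert_nil (lin0 (@snocL _ _ _ _ _)) subr0.
  case: p => [|p]; last first.
    by rewrite insertS_cons insert_nil (lin0 (@cnsL _ _ _ _ _)) oppr0; exact: submod0.
  rewrite insert0_cons; apply: submod_sum => i _; apply: lspan_gen.
  exists (r i * proj z), (cns (l i) (wt_nil T)); split; last by rewrite snoc_cons.
  exact: Ir.
move: (IH p.-1 (fun k => x k.+1)); move: (word n _) (x 0%N) => w {}x wI.
rewrite snoc_cons; case: p wI => [|p] /= wI.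
  rewrite !insert0_cons (lin_sum _ _ _ (@snocL _ _ _ _ _)) -sumrB.
  by rewrite big1 => [|i _]; [exact: lspan0|rewrite !snoc_cons subrr].
rewrite !insertS_cons (linN (@snocL _ _ _ _ _)) snoc_cons -opprD.
rewrite -(linB (@cnsL _ _ _ _ _)); apply: (@submodN _ _ (lspan _)).
move: wI; apply: lspan_map; first exact: cnsL.
move=> _ [y [u [Iy ->]]]; apply: lspan_gen; exists y, (cns x u).
by rewrite snoc_cons.
Qed.

(** Insertion behind the first letter commutes with the wrap, except at the last letter: the wrap
    then multiplies a letter of [I] into the first position. *)
Lemma wrap_insert p n (v : T n.+2) : words_hit 1 n.+2 (wrap (insert p.+1 v) - insert p.+1
  (wrap v)).
Proof.
apply: (@word_all _ _ _ _ _ _ (fun v => wrap (insert p.+1 v) - insert p.+1 (wrap v))).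
  apply: linear_add; last apply: linear_opp; apply: linear_comp;
    by [exact: wrapL|exact: insertL].
move=> x; rewrite (_ : word n.+2 x = cns (x 0%N) (word n.+1 (fun k => x k.+1))) //.
rewrite word_snoc; move: (x 0%N) (x n.+1) (word n _) => {}x z w.
have lamE y (u : T n.+1) : wrap (cns x (snoc y u)) = cns (y * x) u.
  by rewrite -snoc_cons wrap_snoc mul_head_cons.
rewrite insertS_cons -snoc_cons wrap_snoc mul_head_cons insertS_cons (linN (@wrapL _ _ _
  _)).
rewrite -lamE -opprD -(linB (@wrapL _ _ _ _)) -(linB (@cnsL _ _ _ _ _)).
apply: submodN; move: (insert_snoc p z w); move: (_ - _) => {}v.
apply: (lspan_map (f := fun v => wrap (cns x v))).
  by apply: linear_comp; [exact: wrapL|exact: cnsL].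
by move=> _ [y [u [Iy ->]]]; rewrite lamE; apply: words_hit_cons0; exact: Ir.
Qed.

(** The bar part is [bar_insert], and the wrap parts cancel up to [words_hit 1]. That error is
    negligible only from position 1 on, so the first letter gets the separate homotopy
    [conj_htpy]. *)
Lemma hoch_insert p n (v : T n.+1) : words_hit p.+2 n.+1 v ->
  words_hit p.+1 n.+1 (hoch (insert p.+1 v) + insert p.+1 (hoch v) - v).
Proof.
move=> vI; have := bar_insert vI; case: n v vI => [|n] v vI bI.
  (* A one-letter word has no letter at position [p.+1]. *)
  have i0 : insert p.+1 v = 0.
    move: v {vI bI}; apply: (@cons_eq _ _ _ _ _ (@insert p.+1 1) (fun=> 0)) => [||x w].
    - exact: insertL.
    - exact: linear_zero.
    - by rewrite insertS_cons insert_nil (lin0 (@cnsL _ _ _ _ _)) oppr0.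
  by move: bI; rewrite hochS i0 (lin0 (@wrapL _ _ _ _)) scaler0 !insert_nil !addr0.
rewrite !hochS (linD (@insertL _ _)) (linZ (@insertL _ _)) [(-1) ^+ n.+2]exprS mulN1r.
rewrite scaleNr addrACA [_ - v]addrAC; apply: submodD => //.
rewrite addrC -scalerBr; apply: submodZ; rewrite -opprB; apply: submodN.
by apply: words_hitW (wrap_insert p v).
Qed.

Definition filtration p n := addsub (inP n) (words_hit p n).

(** With z = c + v, the boundary of [v] lies over [P], as those of [z] and [c] do, and [insert]
    keeps it there. So subtracting the boundary of [insert p.+1 v] trades [v] for an element over
    [P] and an error one step lower in the filtration. *)
Lemma filtration_step p n (z : T n.+1) : filtration p.+2 n.+1 z -> inP n (hoch z) ->
  exists w, filtration p.+1 n.+1 (z - hoch w).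
Proof.
move=> [c [v [cP vI zE]]] zP; exists (insert p.+1 v).
have hvP : inP n (hoch v).
  have -> : hoch v = hoch z - hoch c by rewrite zE (linD (@hochL _ _ _ _)) addrC addKr.
  by apply: submodB => //; exact: hoch_words_in.
exists (c + insert p.+1 (hoch v)), (- (hoch (insert p.+1 v) + insert p.+1 (hoch v) - v));
  split.
- by apply: submodD => //; exact: insert_words_in.
- by apply: submodN; exact: hoch_insert.
rewrite zE opprB [hoch (insert _ _) + _]addrC [- (insert _ _ + _)]opprD [v + _]addrCA.
by rewrite [RHS]addrA addrK addrA.
Qed.

(* the (i, k) entry of the word in matrices obtained by applying x |-> (r_i x l_j)
   to every letter *)
Fixpoint wconj n (i k : 'I_N) : T n -> T n :=
  match n return T n -> T n with
  | 0 => fun w => (i == k)%:R *: w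
  | n'.+1 => wt_lift (fun x w => \sum_j cns (r i * x * l j) (wconj j k w))
  end.

Fact wconj_aux n i k : (forall j, linear (@wconj n j k)) ->
  bilinear2 (fun x (w : T n) => \sum_j cns (r i * x * l j) (wconj j k w)).
Proof.
move=> cL; split=> [w|x]; apply: linear_sum_fun => j.
  apply: (linear_comp (cnsl (wconj j k w))).
  by apply: (linear_comp (linear_mulr _)); exact: linear_mull.
by apply: linear_comp; [exact: cnsL|exact: cL].
Qed.

Lemma wconjL n i k : linear (@wconj n i k).
Proof.
elim: n i => [|n IH] i; first by apply: linear_scale; exact: linear_id.
by apply: wt_lift_linear; exact: wconj_aux.
Qed.

Lemma wconj_cons n i k x (w : T n) :
  wconj i k (cns x w) = \sum_j cns (r i * x * l j) (wconj j k w).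
Proof. by rewrite /= wt_liftE //; apply: wconj_aux => j; exact: wconjL. Qed.

Lemma wconj_nil i k (w : T 0) : wconj i k w = (i == k)%:R *: w. Proof. by []. Qed.

Arguments wconj : simpl never.

(** Whatever the letter x, r_i x is in [I], and l_j is in both [I] and [P]; so r_i x l_j is in [P]
    by [IPP]. *)
Lemma wconj_words_in n i k (w : T n) : inP n (wconj i k w).
Proof.
apply: word_all; first exact: wconjL.
elim: n i {w} => [|n IH] i x; first exact: words_in_nil.
rewrite [word _ _]/= wconj_cons; apply: submod_sum => j _; apply: words_in_cons => //.
by apply: IPP => //; exact: Ir.
Qed.

(* x |-> (r_i x l_j) is multiplicative because \sum_j l_j r_j is the unit of I *)
Lemma mul_head_wconj n a k y (u : T n) :
  \sum_j mul_head (a * l j) (wconj j k (cns y u)) = \sum_m cns (a * y * l m) (wconj m k u).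
Proof.
under eq_bigr => j _ do rewrite wconj_cons (lin_sum _ _ _ (@mul_headL _ _ _ _ _)).
rewrite exchange_big; apply: eq_bigr => m _ /=.
under eq_bigr => j _ do rewrite mul_head_cons.
rewrite -(lin_sum _ _ _ (cnsl _)); congr cns.
rewrite -mulrA -[in RHS](lr1 (Il y (lI m))) mulr_sumr; apply: eq_bigr => j _.
by rewrite !mulrA.
Qed.

Lemma wconj_mul_head n i k x (w : T n.+1) :
  wconj i k (mul_head x w) = \sum_j mul_head (r i * x * l j) (wconj j k w).
Proof.
move: w; apply: cons_eq => [||y u].
- by apply: linear_comp; [exact: wconjL|exact: mul_headL].
- by apply: linear_sum_fun => j; apply: linear_comp; [exact: mul_headL|exact: wconjL].
by rewrite mul_head_cons wconj_cons mul_head_wconj; apply: eq_bigr => j _; rewrite !mulrA.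
Qed.

Lemma bar_wconj n i k (v : T n.+1) : bar (wconj i k v) = wconj i k (bar v).
Proof.
elim: n i v => [|n IH] i; first by move=> v; rewrite /bar (lin0 (@wconjL _ _ _)).
apply: cons_eq => [||x w].
- by apply: linear_comp; [exact: barL|exact: wconjL].
- by apply: linear_comp; [exact: wconjL|exact: barL].
rewrite wconj_cons (lin_sum _ _ _ (@barL _ _ _ _)) bar_cons (linB (@wconjL _ _ _)).
rewrite wconj_mul_head wconj_cons -sumrB; apply: eq_bigr => j _.
by rewrite bar_cons IH.
Qed.

(* the alternating sum over j of a_1 ... a_j l_i (r_i a_{j+1} l_i') ... (r_i'' a_n l_k) *)
Fixpoint prefix_conj n (k : 'I_N) : T n -> T n.+1 :=
  match n return T n -> T n.+1 with
  | 0 => fun w => cns (l k) w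
  | n'.+1 => wt_lift (fun x w =>
      - cns x (prefix_conj k w) + \sum_i cns (l i) (wconj i k (cns x w)))
  end.

Fact prefix_conj_aux n k : linear (@prefix_conj n k) ->
  bilinear2 (fun x (w : T n) => - cns x (prefix_conj k w) + \sum_i cns (l i) (wconj i k
    (cns x w))).
Proof.
move=> hL; split=> [w|x]; apply: linear_add.
- by apply: linear_opp; exact: cnsl.
- apply: linear_sum_fun => i; apply: linear_comp; first exact: cnsL.
  by apply: (linear_comp (@wconjL _ i k)); exact: cnsl.
- by apply: linear_opp; apply: linear_comp; [exact: cnsL|exact: hL].
- apply: linear_sum_fun => i; apply: linear_comp; first exact: cnsL.
  by apply: (linear_comp (@wconjL _ i k)); exact: cnsL.
Qed.

Lemma prefix_conjL n k : linear (@prefix_conj n k).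
Proof.
elim: n => [|n IH]; first exact: cnsL.
by apply: wt_lift_linear; exact: prefix_conj_aux.
Qed.

Lemma prefix_conj_cons n k x (w : T n) :
  prefix_conj k (cns x w) = - cns x (prefix_conj k w) + \sum_i cns (l i) (wconj i k (cns
    x w)).
Proof. by rewrite /= wt_liftE //; apply: prefix_conj_aux; exact: prefix_conjL. Qed.

Lemma prefix_conj_nil k (w : T 0) : prefix_conj k w = cns (l k) w. Proof. by []. Qed.

Arguments prefix_conj : simpl never.

Lemma prefix_conj_words_in n k (w : T n) : inP n w -> inP n.+1 (prefix_conj k w).
Proof.
apply: words_in_ind; first exact: prefix_conjL.
elim: n {w} => [|n IH] x Px; first by apply: words_in_cons => //; exact: words_in_nil.
rewrite [word _ _]/= prefix_conj_cons; apply: submodD.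
  apply: submodN; apply: words_in_cons; first exact: (Px 0%N).
  by apply: IH => m mn; exact: (Px m.+1).
by apply: submod_sum => i _; apply: words_in_cons => //; exact: wconj_words_in.
Qed.

Lemma prefix_conj_mul_head n k x (w : T n.+1) :
  prefix_conj k (mul_head x w) = mul_head x (prefix_conj k w) - \sum_m cns (x * l m)
    (wconj m k w)
    + \sum_i cns (l i) (wconj i k (mul_head x w)).
Proof.
move: w; apply: cons_eq => [||y u].
- by apply: linear_comp; [exact: prefix_conjL|exact: mul_headL].
- apply: linear_add; last first.
    apply: linear_sum_fun => i; apply: linear_comp; first exact: cnsL.
    by apply: (linear_comp (@wconjL _ i k)); exact: mul_headL.
  apply: linear_add; first by apply: linear_comp; [exact: mul_headL|exact: prefix_conjL].
  apply: linear_opp; apply: linear_sum_fun => i.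
  by apply: linear_comp; [exact: cnsL|exact: wconjL].
rewrite mul_head_cons !prefix_conj_cons; congr (_ + _).
rewrite (linD (@mul_headL _ _ _ _ _)) (linN (@mul_headL _ _ _ _ _)) mul_head_cons.
rewrite (lin_sum _ _ _ (@mul_headL _ _ _ _ _)).
by under eq_bigr => i _ do rewrite mul_head_cons; rewrite addrK.
Qed.

(** The sum telescopes: since the l_i r_i add up to the unit of [I], joining l_i to the conjugated
    letter after it gives the same word as joining the prefix to its l in the next summand, with the
    opposite sign. *)
Lemma bar_prefix_conj n k (v : T n.+1) : bar (prefix_conj k v) = - prefix_conj k (bar v).
Proof.
elim: n v => [|n IH]; apply: cons_eq => [||x w];
  try (by apply: linear_comp; [exact: barL|exact: prefix_conjL]);
  try (by apply: linear_opp; apply: linear_comp; [exact: prefix_conjL|exact: barL]).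
  rewrite prefix_conj_cons (linD (@barL _ _ _ _)) (linN (@barL _ _ _ _)) bar_cons.
  rewrite prefix_conj_nil mul_head_cons [bar (cns (l k) w)]/bar (lin0 (@cnsL _ _ _ _ _))
    subr0.
  rewrite (lin_sum _ _ _ (@barL _ _ _ _)).
  under eq_bigr => i _.
    rewrite bar_cons [bar _]/bar (lin0 (@cnsL _ _ _ _ _)) subr0.
    rewrite -[l i]mul1r; over.
  rewrite mul_head_wconj [prefix_conj k _](lin0 (@prefix_conjL _ _)) oppr0 (bigD1 k) //=
    wconj_nil eqxx scale1r.
  rewrite mul1r big1 ?addr0 ?addNr // => j jk.
  by rewrite wconj_nil (negbTE jk) scale0r (lin0 (@cnsL _ _ _ _ _)).
rewrite prefix_conj_cons (linD (@barL _ _ _ _)) (linN (@barL _ _ _ _)) bar_cons IH.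
rewrite (lin_sum _ _ _ (@barL _ _ _ _)).
(* Writing l_i as 1 l_i brings the sum into the form of [mul_head_wconj]. *)
under eq_bigr => i _ do rewrite bar_cons -[X in mul_head X _]mul1r bar_wconj.
rewrite big_split /= mul_head_wconj bar_cons (linB (@prefix_conjL _ _))
  prefix_conj_mul_head prefix_conj_cons.
under [X in _ + (X + _) = _]eq_bigr => m _ do rewrite mul1r.
rewrite sumrN; under [X in _ + (_ - X) = _]eq_bigr => i _ do
  rewrite (linB (@wconjL _ _ _)) (linB (@cnsL _ _ _ _ _)).
rewrite sumrB (linN (@cnsL _ _ _ _ _)) !opprD !opprK -!addrA; congr (_ + _).
by rewrite [LHS]addrCA; congr (_ + _); rewrite [LHS]addrCA.
Qed.

(** On words with first letter in [I], a homotopy between the identity and the generalized trace of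
    the conjugated words; [proj] extends it to all words so that words over [P] are preserved. *)
Definition conj_htpy n : T n.+1 -> T n.+2 :=
  wt_lift (fun y w => \sum_k cns (r k * proj y) (prefix_conj k w)).

Fact conj_htpy_aux n :
  bilinear2 (fun y (w : T n) => \sum_k cns (r k * proj y) (prefix_conj k w)).
Proof.
split=> [w|y]; apply: linear_sum_fun => k.
  apply: (linear_comp (cnsl (prefix_conj k w))).
  by apply: (linear_comp (linear_mull (r k))); exact: linearP.
by apply: linear_comp; [exact: cnsL|exact: prefix_conjL].
Qed.

Lemma conj_htpyL n : linear (@conj_htpy n).
Proof. exact: (wt_lift_linear (@conj_htpy_aux n)). Qed.

(** Extended by zero to the empty word, where the boundary of a single letter lives. *)
Definition conj_htpyz n : T n -> T n.+1 := if n is n'.+1 then @conj_htpy n' else fun=> 0.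

Lemma conj_htpyzL n : linear (@conj_htpyz n).
Proof. by case: n => [|n]; [exact: linear_zero|exact: conj_htpyL]. Qed.

Lemma conj_htpy_cons n y (w : T n) :
  conj_htpy (cns y w) = \sum_k cns (r k * proj y) (prefix_conj k w).
Proof. by rewrite /conj_htpy wt_liftE //; exact: conj_htpy_aux. Qed.

Lemma conj_htpy_words_in n (w : T n.+1) : inP n.+1 w -> inP n.+2 (conj_htpy w).
Proof.
apply: words_in_ind; first exact: conj_htpyL.
move=> x Px; rewrite [word _ _]/= conj_htpy_cons; apply: submod_sum => k _.
have [Ix Px0] := projP (Px 0%N isT); apply: words_in_cons; first exact: IPP.
by apply: prefix_conj_words_in; apply: words_in_gen => m mn; exact: (Px m.+1).
Qed.

(** The right-hand side is the generalized trace. By [bar_prefix_conj] only the products with the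
    first letter survive, and among these only the summands with empty prefix. *)
Lemma bar_conj_htpy n y (w : T n) : I y ->
  bar (conj_htpy (cns y w)) + conj_htpyz (bar (cns y w)) = \sum_k \sum_m cns (r k * y * l
    m) (wconj m k w).
Proof.
move=> Iy; rewrite conj_htpy_cons (lin_sum _ _ _ (@barL _ _ _ _)) projI //.
rewrite /conj_htpyz; case: n w => [|n].
  move=> w; rewrite addr0; apply: eq_bigr => k _.
  rewrite bar_cons [bar _]/bar (lin0 (@cnsL _ _ _ _ _)) subr0 prefix_conj_nil mul_head_cons.
  rewrite (bigD1 k) //= wconj_nil eqxx scale1r big1 ?addr0 // => j jk.
  by rewrite wconj_nil (negbTE jk) scale0r (lin0 (@cnsL _ _ _ _ _)).
apply: cons_eq => [||a w].
- apply: linear_add.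
    apply: linear_sum_fun => k; apply: (linear_comp (@barL _ _ _ _)).
    by apply: linear_comp; [exact: cnsL|exact: prefix_conjL].
  apply: (linear_comp (@conj_htpyL _)); apply: (linear_comp (@barL _ _ _ _)).
  exact: cnsL.
- apply: linear_sum_fun => k; apply: linear_sum_fun => m.
  by apply: linear_comp; [exact: cnsL|exact: wconjL].
rewrite bar_cons (linB (@conj_htpyL _)) mul_head_cons !conj_htpy_cons !projI //;
  last exact: Ir.
rewrite -sumrB -big_split; apply: eq_bigr => k _ /=.
rewrite bar_cons bar_prefix_conj (linN (@cnsL _ _ _ _ _)) opprK addrACA subrr addr0.
rewrite prefix_conj_cons (linD (@mul_headL _ _ _ _ _)) (linN (@mul_headL _ _ _ _ _))
  mul_head_cons.
rewrite (lin_sum _ _ _ (@mul_headL _ _ _ _ _)) mulrA addrAC addNr add0r.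
by apply: eq_bigr => i _; rewrite mul_head_cons.
Qed.

(** Exposes the last letter, on which the wrap acts: it is l_k in the summand without conjugated
    letters and r_j z l_k in all others. *)
Lemma prefix_conj_snoc n k z (w : T n) : prefix_conj k (snoc z w) =
  (-1) ^+ n.+1 *: snoc (l k) (snoc z w) + \sum_j snoc (r j * z * l k) (prefix_conj j w).
Proof.
elim: n w => [|n IH].
  apply: (@word_eq _ _ _ 0) => [||x].
  - by apply: linear_comp; [exact: prefix_conjL|exact: snocL].
  - apply: linear_add.
      by apply: linear_scale; apply: linear_comp; exact: snocL.
    by apply: linear_sum_fun => j; apply: linear_comp; [exact: snocL|exact: prefix_conjL].
  rewrite [word 0 x]/= snoc_nil prefix_conj_cons prefix_conj_nil expr1 scaleN1r snoc_cons
    snoc_nil.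
  congr (_ + _); apply: eq_bigr => i _.
  rewrite prefix_conj_nil snoc_cons snoc_nil wconj_cons; congr cns.
  rewrite (bigD1 k) //= wconj_nil eqxx scale1r big1 ?addr0 // => j jk.
  by rewrite wconj_nil (negbTE jk) scale0r (lin0 (@cnsL _ _ _ _ _)).
have wconj_snoc m i (u : T m) : wconj i k (snoc z u) = \sum_j snoc (r j * z * l k) (wconj
  i j u).
  elim: m i u => [|m IHm] i.
    apply: (@word_eq _ _ _ 0) => [||x].
    - by apply: linear_comp; [exact: wconjL|exact: snocL].
    - by apply: linear_sum_fun => j; apply: linear_comp; [exact: snocL|exact: wconjL].
    rewrite [word 0 x]/= snoc_nil wconj_cons.
    rewrite (bigD1 k) //= wconj_nil eqxx scale1r big1 ?addr0 => [|j jk]; last first.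
      by rewrite wconj_nil (negbTE jk) scale0r (lin0 (@cnsL _ _ _ _ _)).
    rewrite (bigD1 i) //= wconj_nil eqxx scale1r snoc_nil big1 ?addr0 // => j jk.
    by rewrite wconj_nil eq_sym (negbTE jk) scale0r (lin0 (@snocL _ _ _ _ _)).
  apply: cons_eq => [||x u].
  - by apply: linear_comp; [exact: wconjL|exact: snocL].
  - by apply: linear_sum_fun => j; apply: linear_comp; [exact: snocL|exact: wconjL].
  rewrite snoc_cons wconj_cons.
  under [RHS]eq_bigr => j _ do rewrite wconj_cons (lin_sum _ _ _ (@snocL _ _ _ _ _)).
  rewrite exchange_big; apply: eq_bigr => m' _ /=.
  rewrite IHm (lin_sum _ _ _ (@cnsL _ _ _ _ _)); apply: eq_bigr => j _.
  by rewrite snoc_cons.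
apply: cons_eq => [||x w].
- by apply: linear_comp; [exact: prefix_conjL|exact: snocL].
- apply: linear_add.
    by apply: linear_scale; apply: linear_comp; exact: snocL.
  by apply: linear_sum_fun => j; apply: linear_comp; [exact: snocL|exact: prefix_conjL].
rewrite snoc_cons prefix_conj_cons IH (linD (@cnsL _ _ _ _ _)) (linZ (@cnsL _ _ _ _ _)).
rewrite opprD -scaleNr -mulN1r -exprS -addrA !snoc_cons; congr (_ + _).
under [RHS]eq_bigr => j _ do
  rewrite prefix_conj_cons (linD (@snocL _ _ _ _ _)) (linN (@snocL _ _ _ _ _)) snoc_cons.
rewrite big_split /= sumrN (lin_sum _ _ _ (@cnsL _ _ _ _ _)); congr (_ + _).
under [RHS]eq_bigr => j _ do rewrite (lin_sum _ _ _ (@snocL _ _ _ _ _)).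
rewrite exchange_big; apply: eq_bigr => i _ /=.
rewrite -snoc_cons wconj_snoc (lin_sum _ _ _ (@cnsL _ _ _ _ _)); apply: eq_bigr => j _.
by rewrite snoc_cons.
Qed.

Definition wrapz n : T n.+1 -> T n := if n is n'.+1 then @wrap _ _ _ n' else fun=> 0.

Lemma hochE n (w : T n.+1) : hoch w = bar w + (-1) ^+ n *: wrapz w.
Proof. by case: n w => // w; rewrite scaler0 addr0. Qed.

(** The summand ending in l_k wraps to l_k r_k y, which sums to y and returns the word. In the
    others r_j z l_k r_k y sums to r_j z y, so they cancel the homotopy applied to the wrap. *)
Lemma wrap_conj_htpy n y (w : T n) : I y ->
  (-1) ^+ n.+1 *: wrap (conj_htpy (cns y w)) + (-1) ^+ n *: conj_htpyz (wrapz (cns y w))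
    = - cns y w.
Proof.
move=> Iy; rewrite conj_htpy_cons (lin_sum _ _ _ (@wrapL _ _ _ _)) projI //.
have lamE m x z (u : T m) : wrap (cns x (snoc z u)) = cns (z * x) u.
  by rewrite -snoc_cons wrap_snoc mul_head_cons.
have sumE u : \sum_k cns (l k * (r k * y)) u = cns y u :> T n.+1.
  by rewrite -(lin_sum _ _ _ (cnsl u)) lr1.
rewrite /conj_htpyz /wrapz; case: n w sumE => [|n] w sumE.
  rewrite scaler0 addr0 expr1 scaleN1r; congr (- _); rewrite -sumE; apply: eq_bigr => k _.
  by rewrite prefix_conj_nil -(lamE _ _ _ w).
move: w; apply: snoc_eq => [||z u].
- apply: linear_add; apply: linear_scale.
    apply: linear_sum_fun => k; apply: (linear_comp (@wrapL _ _ _ _)).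
    by apply: linear_comp; [exact: cnsL|exact: prefix_conjL].
  apply: (linear_comp (@conj_htpyL _)); apply: (linear_comp (@wrapL _ _ _ _)).
  exact: cnsL.
- by apply: linear_opp; exact: cnsL.
have ss k : (-1) ^+ k * (-1) ^+ k = 1 :> F by rewrite -expr2 sqrr_sign.
under eq_bigr => k _ do rewrite prefix_conj_snoc (linD (@cnsL _ _ _ _ _))
  (linZ (@cnsL _ _ _ _ _)) (lin_sum _ _ _ (@cnsL _ _ _ _ _))
  (linD (@wrapL _ _ _ _)) (linZ (@wrapL _ _ _ _)) (lin_sum _ _ _ (@wrapL _ _ _ _)) lamE.
rewrite big_split /= -scaler_sumr sumE scalerDr scalerA [(-1) ^+ n.+2]exprS.
rewrite mulN1r mulNr ss scaleN1r -addrA.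
rewrite -[RHS]addr0; congr (_ + _); rewrite lamE conj_htpy_cons projI; last exact: Il.
apply/eqP; rewrite scaleNr addrC subr_eq0; apply/eqP; congr (_ *: _).
rewrite exchange_big; apply: eq_bigr => j _ /=.
under eq_bigr => k _ do rewrite lamE.
rewrite -(lin_sum _ _ _ (cnsl _)); congr cns.
rewrite -{1}(lr1 Iy) !mulr_sumr; apply: eq_bigr => k _.
by rewrite !mulrA.
Qed.

(** The wrap terms contribute minus [v], the bar terms the generalized trace, all of whose letters
    lie in [P]. *)
Lemma hoch_conj_htpy n (v : T n.+1) : words_hit 1 n.+1 v ->
  inP n.+1 (v + (hoch (conj_htpy v) + conj_htpyz (hoch v))).
Proof.
apply: (words_hit_ind (f := fun v => v + (hoch (conj_htpy v) + conj_htpyz (hoch v)))).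
  apply: linear_add; first exact: linear_id.
  by apply: linear_add; apply: linear_comp;
    [exact: hochL|exact: conj_htpyL|exact: conj_htpyzL|exact: hochL].
move=> x [] // _ _ Ix; rewrite [word _ _]/=; move: (word n _) => w.
rewrite !hochE (linD (@conj_htpyzL _)) (linZ (@conj_htpyzL _)) addrACA wrap_conj_htpy //
  bar_conj_htpy //.
rewrite addrCA subrr addr0; apply: submod_sum => k _; apply: submod_sum => m _.
by apply: words_in_cons; [apply: IPP => //; exact: Ir|exact: wconj_words_in].
Qed.

(** The argument of [filtration_step] with [conj_htpy] in place of [insert]; the error now lies over
    [P]. *)
Lemma filtration_base n (z : T n.+1) : filtration 1 n.+1 z -> inP n (hoch z) ->
  exists w, inP n.+1 (z - hoch w).
Proof.
move=> [c [v [cP vI zE]]] zP; exists (- conj_htpy v).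
have hvP : inP n (hoch v).
  have -> : hoch v = hoch z - hoch c by rewrite zE (linD (@hochL _ _ _ _)) addrC addKr.
  by apply: submodB => //; exact: hoch_words_in.
rewrite (linN (@hochL _ _ _ _)) opprK zE -addrA; apply: submodD => //.
rewrite -[v + _](addrK (conj_htpyz (hoch v))) -[X in X - _]addrA.
apply: submodB; first exact: hoch_conj_htpy.
move: (hoch v) hvP => u; case: n u {c v z cP vI zE zP} => [|n] u uP.
  exact: submod0.
exact: conj_htpy_words_in.
Qed.

Lemma filtration_exact p n (z : T n.+1) : filtration p.+1 n.+1 z -> inP n (hoch z) ->
  exists w, inP n.+1 (z - hoch w).
Proof.
elim: p z => [|p IH] z zY zP; first exact: filtration_base.
have [w wY] := filtration_step zY zP.
have [|u uP] := IH _ wY.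
  by rewrite (linB (@hochL _ _ _ _)) hoch_hoch subr0.
by exists (w + u); rewrite (linD (@hochL _ _ _ _)) opprD addrA.
Qed.

(** Expanding the letters places [z] in the filtration, which is then descended. The chain [w] is
    not confined to words over [P']: comparison with all words over [E] suffices. *)
Lemma relative_exact (P' : set E) n (z : T n.+1) :
  (forall x, P' x -> exists y y', [/\ P y, I y' & x = y + y']) ->
  words_in T P' n.+1 z -> inP n (hoch z) -> exists w, inP n.+1 (z - hoch w).
Proof.
by move=> P'E zP'; apply: (@filtration_exact n); exact: words_in_word_expand zP'.
Qed.

End Excision.

(** * Periodic cyclic homology *)

Section TotalComplex.
Variables (F : fieldType) (E : algType F) (T : word_tower E) (P : set E).
Hypothesis PM : forall x y, P x -> P y -> P (x * y).
Local Notation words_in := (words_in T P).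

(** The flag [c] is true for even columns; [bdrow c] is the horizontal map arriving in such a
    column. *)
Definition bdcol c n (v : T n.+1) : T n := if c then hoch v else - bar v.
Definition bdrow c n (v : T n.+1) : T n.+1 := if c then v - cyc v else cnorm v.
Definition total_bd m (x : forall q, T q.+1) q : T q.+1 :=
  bdcol (m (+) odd q) (x q.+1) + bdrow (m (+) odd q) (x q).

Lemma bdcolL c n : linear (@bdcol c n).
Proof.
rewrite /bdcol; case: c; first exact: hochL.
by apply: linear_opp; exact: barL.
Qed.

Lemma bdrowL c n : linear (@bdrow c n).
Proof.
rewrite /bdrow; case: c; last exact: cnormL.
by apply: linear_add; [exact: linear_id|apply: linear_opp; exact: cycL].
Qed.

Lemma bdcol_bdcol c n (v : T n.+2) : bdcol c (bdcol c v) = 0.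
Proof.
rewrite /bdcol; case: c; first exact: hoch_hoch.
by rewrite (linN (@barL _ _ _ _)) bar_bar !oppr0.
Qed.

Lemma bdrow_bdrow c n (v : T n.+1) : bdrow c (bdrow (~~ c) v) = 0.
Proof.
rewrite /bdrow; case: c; first by rewrite cyc_cnorm subrr.
by rewrite (linB (@cnormL _ _ _ _)) cnorm_cyc subrr.
Qed.

Lemma bdcol_bdrow c n (v : T n.+2) : bdcol c (bdrow c v) = - bdrow c (bdcol (~~ c) v).
Proof.
rewrite /bdrow /bdcol; case: c.
  rewrite hoch_cyc (linN (@cycL _ _ _ _)) opprB opprK; exact: addrC.
by rewrite bar_cnorm.
Qed.

Lemma bdrow_words_in c n v : words_in n.+1 v -> words_in n.+1 (bdrow c v).
Proof.
move=> vP; rewrite /bdrow; case: c; last exact: cnorm_words_in.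
by apply: submodB => //; exact: cyc_words_in.
Qed.

Lemma total_bd_total_bd m x q : total_bd m (total_bd (~~ m) x) q = 0.
Proof.
rewrite /total_bd; set c := m (+) odd q.
have -> : ~~ m (+) odd q.+1 = c by rewrite /c /= addbN addNb negbK.
have -> : ~~ m (+) odd q = ~~ c by rewrite /c addNb.
rewrite (linD (@bdcolL _ _)) (linD (@bdrowL _ _)) bdcol_bdcol bdrow_bdrow bdcol_bdrow.
by rewrite add0r addr0 addNr.
Qed.

Hypothesis bdcol_exact : forall c n (z : T n.+1), words_in n (bdcol c z) ->
  exists w, words_in n.+1 (z - bdcol c w).

(** The rows of [w] are found one after another; totalizing by products imposes no finiteness on
    them. *)
Lemma total_bd_exact m z : (forall q, words_in q.+1 (total_bd m z q)) ->
  exists w, forall q, words_in q.+1 (z q - total_bd (~~ m) w q).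
Proof.
have oddS b q : ~~ b (+) odd q.+1 = b (+) odd q by case: b => /=; rewrite ?negbK.
move=> zP; pose c q := ~~ m (+) odd q.
(* With [u] as row [q] of [w], what remains of [z] in that row has its column boundary over [P], so
   exactness of the column provides the next row. At [q = 0] nothing is required, as the empty word
   is over [P]. *)
pose inv q (u : T q.+1) := words_in q (bdcol (c q) (z q - bdrow (c q) u)).
have inv0 : inv 0 0 by exact: words_in_nil.
have step q u : inv q u -> exists u', words_in q.+1 (z q - (bdcol (c q) u' + bdrow (c q) u))
    /\ inv q.+1 u'.
  move=> /bdcol_exact [u']; rewrite -addrA -opprD [X in z q - X]addrC => uP.
  exists u'; split=> //; rewrite /inv.
  have cS : c q.+1 = m (+) odd q := oddS m q.
  have cE : c q = ~~ c q.+1 by rewrite cS /c addNb.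
  rewrite (linB (@bdcolL _ _)) bdcol_bdrow opprK.
  have -> : bdcol (c q.+1) (z q.+1) = total_bd m z q - bdrow (c q.+1) (z q).
    by rewrite /total_bd cS addrK.
  rewrite -addrA [- _ + _]addrC -(linB (@bdrowL _ _)) -cE.
  apply: submodD; first exact: zP.
  have -> : bdcol (c q) u' - z q = - (z q - (bdcol (c q) u' + bdrow (c q) u)) - bdrow (c
    q) u.
    by rewrite opprB addrAC addrK.
  rewrite (linB (@bdrowL _ _)) {3}cE bdrow_bdrow subr0 (linN (@bdrowL _ _)).
  by apply: submodN; exact: bdrow_words_in.
pose fix w q : {u : T q.+1 | inv q u} :=
  match q with
  | 0 => exist _ 0 inv0
  | q'.+1 => let: exist u iu := w q' in
             let: exist u' iu' := cid (step q' u iu) in exist _ u' iu'.2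
  end.
exists (fun q => sval (w q)) => q; rewrite /total_bd -/(c q) /=.
by case: (w q) => u iu /=; case: (cid _) => u' [].
Qed.

End TotalComplex.

(** * Comparison with the operators on tuples *)

Section FrozenOperators.
Variables (F : fieldType) (E : algType F).
Local Notation T := (tpow_words E).

Lemma tens_word n x : tens (nat_tuple n x) = word T n x.
Proof.
elim: n x => [|n IH] x; first exact: tens0E.
rewrite [RHS]/= -IH; apply: etrans (esym (consT_tens _ _)); congr tens.
by rewrite cons_nat_tuple; apply: eq_nat_tuple => -[|k].
Qed.

Lemma bprime_bar q (u : tpow E q.+2) : bprime u = bar (u : T q.+2).
Proof.
move: u; apply: (@word_eq _ _ T q.+2) => [||x].
- exact: bprime_linear.
- exact: barL.
rewrite bar_word -tens_word /bprime tlift_tens; last first.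
  by apply: multilinear_sum => i; exact: face_multilinear.
apply: eq_bigr => i _; rewrite -tens_word; congr (_ *: tens _).
apply/ffunP => j; rewrite !ffunE /wface_seq /= /bump /= !add1n.
by [].
Qed.

Lemma blast_wrap q (u : tpow E q.+2) : blast u = wrap (u : T q.+2).
Proof.
move: u; apply: (@word_eq _ _ T q.+2) => [||x].
- exact: blast_linear.
- exact: wrapL.
rewrite wrap_word -tens_word /blast tlift_tens; last exact: last_face_multilinear.
rewrite -tens_word; congr tens.
by apply/ffunP => j; rewrite !ffunE /=; case: (nat_of_ord j).
Qed.

Lemma hochb_hoch q (u : tpow E q.+2) : hochb u = hoch (u : T q.+2).
Proof. by rewrite /hochb bprime_bar blast_wrap. Qed.

Lemma tcyc_cyc q (u : tpow E q.+1) : tcyc u = cyc (u : T q.+1).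
Proof.
rewrite /tcyc /cyc; congr (_ *: _); move: u; apply: (@word_eq _ _ T q.+1) => [||x].
- exact: tunsigned_linear.
- exact: wrotL.
rewrite wrot_word -tens_word /tunsigned tlift_tens; last exact: rot_tuple_multilinear.
rewrite -tens_word; congr tens.
apply/ffunP => j; rewrite !ffunE /=; case: j => [[|k] kq] /=.
  by rewrite modn_small.
by rewrite modnDr modn_small // ltnW.
Qed.

Lemma tnorm_cnorm q (u : tpow E q.+1) : tnorm u = cnorm (u : T q.+1).
Proof.
rewrite /tnorm /cnorm; apply: eq_bigr => i _.
by elim: (i : nat) => [//|m IHm]; rewrite !iterS IHm tcyc_cyc.
Qed.

Lemma hpd_total_bd m (x : chains E) q : hpd m x q = total_bd (T := T) m x q.
Proof.
rewrite /hpd /total_bd /bdcol /bdrow; case: ifP => _.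
  by rewrite hochb_hoch tcyc_cyc.
by rewrite bprime_bar tnorm_cnorm.
Qed.

Lemma hpd_hpd m (x : chains E) : hpd m (hpd (~~ m) x) = 0.
Proof.
apply: functional_extensionality_dep => q; rewrite hpd_total_bd.
rewrite (_ : hpd (~~ m) x = total_bd (T := T) (~~ m) x); last first.
  by apply: functional_extensionality_dep => r; rewrite hpd_total_bd.
exact: (@total_bd_total_bd F E T m x q).
Qed.

End FrozenOperators.

(** * From exact columns to an isomorphism of HP *)

Section HPIso.
Variables (F : fieldType) (A E : algType F) (f : {lrmorphism A -> E}).
Hypothesis f_inj : injective f.
Local Notation T := (tpow_words E).

(** Over a field [f] has a linear retraction, and applying it letter by letter is a left inverse of
    [tpow_map]. *)
Lemma tpow_map_inj n : injective (@tpow_map F A E f n).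
Proof.
have T0 : (fun=> True) (0 : A) by [].
have TP (c : F) (x y : A) : True -> True -> True by [].
have gG : functional_graph (@Submodule _ A (fun=> True) T0 TP)
    [set p : E * A | f p.2 = p.1].
  split=> //=; first by rewrite linear0.
    by move=> c v w v' w' <- <-; rewrite linearP.
  by move=> w; rewrite -(linear0 f) => /f_inj.
have [g [gf _]] := linear_extension gG.
pose tg := tlift (fun a : {ffun 'I_n -> E} => tens [ffun j => g (a j)]).
have gM : multilinear (fun a : {ffun 'I_n -> E} => tens [ffun j => g (a j)]).
  apply: multilinear_tens => a j; exists j, g; split; first exact: linearP.
  by move=> x; apply/ffunP => l; rewrite !ffunE; case: ifP.
apply: (can_inj (g := tg)) => x; move: x; apply: tpow_eq => [||a].
- by apply: linear_comp; [exact: tlift_linear|exact: tpow_map_linear].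
- by [].
rewrite tpow_map_tens /tg tlift_tens //; congr tens.
by apply/ffunP => j; rewrite !ffunE; apply: gf.
Qed.

Lemma words_in_range n (v : tpow E n) : words_in T (range f) n v ->
  exists u, tpow_map f u = v.
Proof.
pose S := [set v : tpow E n | exists u, tpow_map f u = v].
have S0 : S 0 by exists 0; rewrite (lin0 (tpow_map_linear f (n := n))).
have SP (c : F) x y : S x -> S y -> S (c *: x + y).
  by move=> [u <-] [w <-]; exists (c *: u + w); rewrite tpow_map_linear.
apply: (@words_in_ind _ _ T (range f) n _ (Submodule S0 SP) id) => // x xf.
have /choice [y yx] : forall k, exists a, (k < n)%N -> f a = x k.
  move=> k; have [kn|_] := ltnP k n; last by exists 0.
  by have [a _ ax] := xf k kn; exists a.
exists (tens (nat_tuple n y)); rewrite tpow_map_tens -tens_word; congr tens.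
by apply/ffunP => j; rewrite !ffunE yx.
Qed.

Hypothesis bdcol_exact : forall c n (z : T n.+1), words_in T (range f) n (bdcol c z) ->
  exists w, words_in T (range f) n.+1 (z - bdcol c w).

Lemma chains_map_inj : injective (chains_map f).
Proof.
move=> x y xy; apply: functional_extensionality_dep => q.
by apply: tpow_map_inj; exact: (congr1 (fun h : chains E => h q) xy).
Qed.

(** Acyclicity of the cokernel of [chains_map f], deduced from the columns by [total_bd_exact]. *)
Lemma hpd_exact m (z : chains E) : (exists x, hpd m z = chains_map f x) ->
  exists w x, z = hpd (~~ m) w + chains_map f x.
Proof.
move=> [x zx].
have zP q : words_in T (range f) q.+1 (total_bd (T := T) m z q).
  rewrite -hpd_total_bd zx -[chains_map f x q]/(tpow_map f (x q)); move: (x q);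
    apply: tpow_ind => [|c u v uP vP|a].
  - by rewrite (lin0 (tpow_map_linear f (n := _))); exact: submod0.
  - by rewrite tpow_map_linear; exact: submodP.
  - have [y ->] := nat_tupleP a.
    rewrite tpow_map_tens (_ : tuple_map f _ = nat_tuple q.+1 (f \o y)).
      by rewrite tens_word; apply: words_in_gen => k _; exists (y k).
    by apply/ffunP => j; rewrite !ffunE.
have [w wP] := total_bd_exact bdcol_exact zP.
have wE q : exists u, tpow_map f u = z q - total_bd (T := T) (~~ m) w q.
  exact: words_in_range.
exists w, (fun q => sval (cid (wE q))); apply: functional_extensionality_dep => q.
rewrite -[RHS]/(hpd (~~ m) w q + tpow_map f (sval (cid (wE q)))).
by case: cid => u /= ->; rewrite hpd_total_bd; rewrite addrC subrK.
Qed.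

Lemma HP_map_lpi m (x : cycles (@hpd F A m)) :
  HP_map f m (lpi (boundaries _ _) x) =
  lpi (boundaries _ _) (Cycle (homology_map_cycle (chains_map_hpd f m) x)).
Proof.
rewrite /HP_map /homology_map lquot_lift_pi //.
by move=> y; apply: cycles_map_boundary; exact: (chains_map_hpd f (~~ m)).
Qed.

(** The long exact sequence argument for an injective chain map with acyclic cokernel. *)
Lemma HP_map_bijective m : bijective (HP_map f m).
Proof.
have hinj : injective (HP_map f m).
  move=> X Y XY; apply/eqP; rewrite -subr_eq0; apply/eqP.
  have [x xE] := lpi_surj (X - Y).
  have : HP_map f m (X - Y) = 0 by rewrite (linB (@HP_map_linear F A E f m)) XY subrr.
  rewrite xE HP_map_lpi => h0.
  have /lpiE := etrans h0 (esym (raddf0 (lpi (boundaries (@hpd F E (~~ m)) (@hpd F E m))))).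
  rewrite subr0 => -[w' /= w'E].
  (* A chain bounding the image of [x] is, up to a boundary, the image of some [u], which then
     bounds [x]. *)
  have [|w [u wu]] := @hpd_exact (~~ m) w'; first by exists (cycle_val x).
  apply: etrans (raddf0 (lpi (boundaries (@hpd F A (~~ m)) (@hpd F A m)))).
  apply/lpiE; rewrite subr0; exists u; apply: chains_map_inj.
  by rewrite chains_map_hpd -w'E wu (linD (@hpd_linear F E (~~ m))) hpd_hpd add0r.
have hsurj Y : exists X, HP_map f m X = Y.
  have [[y yc] ->] := lpi_surj Y.
  have y0 : hpd m y = 0 by exact/eqP.
  have [|w [u yE]] := @hpd_exact m y.
    by exists 0; rewrite y0 (lin0 (@chains_map_linear F A E f)).
  have u0 : hpd m u = 0.
    apply: chains_map_inj; rewrite chains_map_hpd (lin0 (@chains_map_linear F A E f)).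
    by rewrite -y0 yE (linD (@hpd_linear F E m)) hpd_hpd add0r.
  have uc : u \in cycle_pred (@hpd F A m) by rewrite unfold_in; apply/eqP; exact: u0.
  exists (lpi (boundaries (@hpd F A (~~ m)) (@hpd F A m)) (Cycle uc)).
  rewrite HP_map_lpi; apply/lpiE; exists (- w).
  apply: etrans (linN (@hpd_linear F E (~~ m)) w) _; rewrite -[RHS]/(chains_map f u - y).
  by rewrite yE opprD addrCA subrr addr0.
have [g gK] := choice hsurj.
by exists g => // X; apply: hinj; rewrite gK.
Qed.

End HPIso.

(** A linear projection [rho] onto the intersection of [P] and [I] is replaced on P + I by x + y |->
    rho x + y, well defined because [rho] fixes the intersection; the result is then extended to
    [V]. *)
Lemma excision_projection (F : fieldType) (V : lmodType F) (P I : submodule V) :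
  exists proj : {linear V -> V},
    (forall x, I x -> proj x = x) /\ (forall x, P x -> I (proj x) /\ P (proj x)).
Proof.
have PI0 : P 0 /\ I 0 by split; exact: submod0.
have PIP (c : F) (x y : V) : P x /\ I x -> P y /\ I y -> P (c *: x + y) /\ I (c *: x + y).
  by move=> [Px Ix] [Py Iy]; split; exact: submodP.
pose PI := @Submodule _ V (fun x => P x /\ I x) PI0 PIP.
have g1 : functional_graph PI [set p : V * V | PI p.1 /\ p.2 = p.1].
  split=> //= [c v w v' w' [PIv ->] [PIv' ->]|w [_ ->]//|v w [PIv ->]//].
  by split=> //; exact: (PIP).
have [rho [rhoE rhoPI]] := linear_extension g1.
have T0 : (fun=> True) (0 : V) by [].
have TP (c : F) (x y : V) : True -> True -> True by [].
have g2 : functional_graph (@Submodule _ V (fun=> True) T0 TP)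
    [set p : V * V | exists x y, [/\ P x, I y, p.1 = x + y & p.2 = rho x + y]].
  split=> //=.
  - by exists 0, 0; rewrite linear0 addr0; split=> //; exact: submod0.
  - move=> c v w v' w' [x [y [Px Iy -> ->]]] [x' [y' [Px' Iy' -> ->]]].
    exists (c *: x + x'), (c *: y + y').
    split; [exact: submodP|exact: submodP| |].
      by rewrite scalerDr addrACA.
    by rewrite (linearP rho) scalerDr addrACA.
  - move=> w [x [y [Px Iy /esym/eqP xy ->]]].
    move: xy; rewrite addrC addr_eq0 => /eqP yE.
    rewrite (rhoE x x) ?yE ?subrr //; split=> //; split=> //.
    by rewrite -[x]opprK -yE; exact: submodN.
have [proj [projE _]] := linear_extension g2.
exists proj; split=> [x Ix|x Px].
  by apply: projE; exists 0, x; rewrite linear0 !add0r; split=> //; exact: submod0.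
have -> : proj x = rho x.
  by apply: projE; exists x, 0; rewrite !addr0; split=> //; exact: submod0.
by have [? ?] := rhoPI x.
Qed.

(* P' is obtained from P by enlarging the left ideal P :&: I of I to I *)
Record excisive (F : fieldType) (E : algType F) (P I P' : set E) : Prop := Excisive {
  exc_mull : forall a x, I x -> I (a * x);
  exc_mulr : forall x a, I x -> I (x * a);
  exc_left : forall x y, I x -> I y -> P y -> P (x * y);
  exc_unit : exists N (l r : 'I_N -> E),
    [/\ forall i, I (l i), forall i, P (l i), forall i, I (r i) &
        forall x, I x -> \sum_i l i * (r i * x) = x];
  exc_sum : forall x, P' x -> exists y z, [/\ P y, I z & x = y + z]
}.

(** * Chains of excisive extensions *)

Section Chain.
Variables (F : fieldType) (A E : algType F) (f : {lrmorphism A -> E}).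
Hypothesis f_inj : injective f.
Variables (n : nat) (Q I : nat -> submodule E).
Hypothesis Q0 : forall x, Q 0%N x <-> range f x.
Hypothesis Qn : forall x, Q n x.
Hypothesis QM : forall m x y, Q m x -> Q m y -> Q m (x * y).
Hypothesis QS : forall m x, Q m x -> Q m.+1 x.
Hypothesis Qexc : forall m, (m < n)%N -> excisive (Q m) (I m) (Q m.+1).
Local Notation T := (tpow_words E).

Lemma words_in_mono (P P' : set E) q (v : T q) : (forall x, P x -> P' x) ->
  words_in T P q v -> words_in T P' q v.
Proof.
move=> PP'; apply: (words_in_ind (f := id)) => // x Px.
by apply: words_in_gen => k kq; apply: PP'; exact: Px.
Qed.

(** Each [relative_exact] moves a chain over [Q m.+1] to one over [Q m] without changing its
    boundary. *)
Lemma hoch_exact_chain m q (z : T q.+1) : (m <= n)%N -> words_in T (Q m) q.+1 z ->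
  words_in T (Q 0%N) q (hoch z) -> exists w, words_in T (Q 0%N) q.+1 (z - hoch w).
Proof.
elim: m z => [|m IH] z mn zQ zP.
  by exists 0; rewrite (lin0 (@hochL _ _ _ _)) subr0.
have [Il Ir IPP [N [l [r [lI lP rI lr1]]]] Qsum] := Qexc mn.
have [proj [projI projP]] := excision_projection (Q m) (I m).
have zPm : words_in T (Q m) q (hoch z).
  apply: words_in_mono zP => x; elim: (m) => // k IHk Qx; apply: QS; exact: IHk.
have [w wQ] := relative_exact Il Ir (@QM m) lI lP rI lr1 IPP projI projP Qsum zQ zPm.
have [|w' w'Q] := IH _ (ltnW mn) wQ.
  by rewrite (linB (@hochL _ _ _ _)) hoch_hoch subr0.
by exists (w + w'); rewrite (linD (@hochL _ _ _ _)) opprD addrA.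
Qed.

Lemma HP_map_bijective_chain m : bijective (HP_map f m).
Proof.
have Qr q (v : T q) : words_in T (Q 0%N) q v <-> words_in T (range f) q v.
  by split; apply: words_in_mono => x /Q0.
apply: HP_map_bijective => // c q z /Qr zc; case: c zc => zc.
  have [|w /Qr wQ] := @hoch_exact_chain n q z (leqnn n) _ zc; last by exists w.
  by apply: (word_all (f := id)) => // x; apply: words_in_gen => k _; exact: Qn.
(* As 1 is in the image of [f], prefixing 1 contracts the b' columns: b'(1 z) = z - 1 b'(z). *)
exists (- wt_cons (1 : E) z); apply/Qr; rewrite /bdcol (linN (@barL _ _ _ _)) opprK.
rewrite bar_cons (_ : mul_head 1 z = z); last first.
  move: z {zc}; apply: cons_eq => [||x w]; [exact: mul_headL|exact: linear_id|].
  by rewrite mul_head_cons mul1r.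
rewrite opprB addrC subrK; apply: words_in_cons.
  by apply/Q0; exists 1; rewrite // rmorph1.
by have := submodN zc; rewrite /bdcol opprK.
Qed.

End Chain.

(** * Affine cellular algebras *)

(** The adjugate of [psi] turns the hypothesis into det(psi) M = 0. *)
Lemma mulmx_det_eq0 (B : comNzRingType) d (M psi : 'M[B]_d) :
  ~ zero_divisor (\det psi) -> M *m psi = 0 -> M = 0.
Proof.
move=> ndet Mpsi; apply/matrixP => s t; rewrite mxE; apply/eqP.
apply: contra_notT ndet => Mst; exists (M s t) => //.
have : M *m psi *m \adj psi = 0 by rewrite Mpsi mul0mx.
by rewrite -mulmxA mul_mx_adj mul_mx_scalar => /matrixP/(_ s t); rewrite !mxE.
Qed.

Section Layers.
Variables (k : comNzRingType) (A : algType k) (i : A -> A) (X : affineCellular i).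
Local Notation n := (ac_len X).
Local Notation J := (partial_sum (@ac_part k A i X)).
Local Notation alpha j := (@cell_iso _ _ (@ac_cell k A i X j)).
Implicit Types j : 'I_n.

Lemma partial_sum_mono m m' a : (m <= m')%N -> J m a -> J m' a.
Proof.
move=> mm' [x Px <-].
exists (fun l : 'I_n => if (l < m)%N then x l else 0).
  by move=> l /=; case: ifP => _; [exact: Px|exact: submod0].
rewrite [LHS]big_mkcond [RHS]big_mkcond; apply: eq_bigr => l _ /=.
by case: (ltnP l m) => lm; [rewrite (leq_trans lm mm')|case: ifP].
Qed.

Lemma partial_sum0 a : J 0%N a -> a = 0.
Proof. by move=> [x _ <-]; rewrite big_pred0. Qed.

Lemma partial_sumT a : J n a.
Proof.
have [x [[Px ->] _]] := ac_direct X a; exists x => //.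
by apply: eq_bigl => l; rewrite ltn_ord.
Qed.

Lemma ac_idealP j a : ac_ideal j a <-> J j a.
Proof. by rewrite -[X in _ <-> X](congr1 (@^~ a) (ac_idealE j)). Qed.

(** In the layer, alpha(a e) = alpha(a) psi alpha(e), and alpha(e) is the identity matrix. *)
Lemma Theta_layer j a : J j.+1 a ->
  Theta X a j = alpha j (qpi (ac_ideal j) a) *m swich X j.
Proof.
move=> Ja; rewrite /Theta /cell_embed /cell_one.
rewrite (cell_iso_form (ac_cellP j)); last exact: (cell_isoVP (ac_cellP j)).
  by rewrite (cell_isoVK (ac_cellP j)) mulmx1.
by exists a.
Qed.

Lemma Theta_ideal j a : J j a -> Theta X a j = 0.
Proof.
move=> /ac_idealP Ia; rewrite /Theta.
have -> : qpi (ac_ideal j) a = qpi (ac_ideal j) 0 by apply/qpiE; rewrite subr0.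
have B0 := cell_embedB (ac_cellP j) 0 0.
by rewrite raddf0; move: B0; rewrite !subrr.
Qed.

Lemma alpha0 j : alpha j 0 = 0.
Proof.
have I0 := ideal2_0 (cell_ideal2 (ac_cellP j)).
by have := cell_isoD (ac_cellP j) I0 I0; rewrite addr0 => /eqP;
  rewrite addrC -subr_eq subrr eq_sym => /eqP.
Qed.

Hypothesis det_swich : forall j, ~ zero_divisor (\det (swich X j)).

(** Downward induction on [m]: an element of [J m.+1] killed in component [m] satisfies alpha(a) psi
    = 0, so alpha(a) = 0 and its class in the layer vanishes. *)
Lemma Theta_ker m a : (m <= n)%N ->
  (forall j : 'I_n, (m <= j)%N -> Theta X a j = 0) -> J m a.
Proof.
move=> mn a0; have [d dE] : exists d, (m + d = n)%N by exists (n - m)%N; rewrite subnKC.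
elim: d m mn a0 dE => [|d IH] m mn a0 dE.
  by rewrite (_ : m = n); [exact: partial_sumT|rewrite -dE addn0].
have mn' : (m < n)%N by rewrite -dE addnS ltnS leq_addr.
have Ja : J m.+1 a.
  apply: IH => //; last by rewrite addSnnS.
  by move=> j mj; apply: a0; exact: ltnW.
pose j := Ordinal mn'.
have := a0 j (leqnn _); rewrite Theta_layer // => /(mulmx_det_eq0 (det_swich (j := j))) q0.
apply/(@ac_idealP j); have : qpi (ac_ideal j) a = qpi (ac_ideal j) 0.
  have La : layer X j (qpi (ac_ideal j) a) by exists a.
  have L0 := ideal2_0 (cell_ideal2 (ac_cellP j)).
  rewrite -(cell_isoK (ac_cellP j) La) q0 -(alpha0 j) (cell_isoK (ac_cellP j) L0).
  by rewrite raddf0.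
by move/qpiE; rewrite subr0.
Qed.

Lemma Theta_inj : injective (Theta X).
Proof.
move=> a b ab; apply/eqP; rewrite -subr_eq0; apply/eqP; apply: partial_sum0.
apply: Theta_ker => // j _.
by rewrite (Theta_zmod_morphism X) ab subrr.
Qed.

Definition asym_single j M : asym X := dfwith (0 : asym X) (i := j) M.

Lemma asym_single_in j M : asym_single M j = M. Proof. exact: dfwith_in. Qed.

Lemma asym_single_out j j' (M : 'M_(cell_rank (ac_cell j))) : j != j' ->
  asym_single M j' = 0.
Proof. by move=> jj'; rewrite /asym_single dfwith_out. Qed.

(** The witness lifts the preimage of [M] under alpha to [J j.+1], which [Theta] kills in all
    components above [j]. *)
Lemma asym_single_swich j M : exists b,
  forall j' : 'I_n, (j <= j')%N -> asym_single (M *m swich X j) j' = Theta X b j'.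
Proof.
have [b Jb bE] := cell_isoVP (ac_cellP j) M.
exists b => j'; rewrite leq_eqVlt => /orP[/eqP/val_inj <-|jj'].
  by rewrite asym_single_in Theta_layer // bE (cell_isoVK (ac_cellP j)).
rewrite asym_single_out; last by rewrite -val_eqE /= ltn_eqF.
by rewrite Theta_ideal //; exact: partial_sum_mono Jb.
Qed.

(** Interpolates between the image of [Theta], at 0, and the whole asymptotic algebra, at the length
    of the chain. *)
Definition theta_above m : set (asym X) :=
  [set x | exists a, forall j : 'I_n, (m <= j)%N -> x j = Theta X a j].

Definition supported_at m : set (asym X) :=
  [set x | forall j : 'I_n, (j != m :> nat) -> x j = 0].

(** The element [a] is killed in the components above [j], so [Theta_ker] places it in [J j.+1],
    where [Theta_layer] applies. *)
Lemma theta_above_supported_at j (x : asym X) : theta_above j x -> supported_at j x ->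
  exists M, x j = M *m swich X j.
Proof.
move=> [a aE] x0; exists (alpha j (qpi (ac_ideal j) a)).
rewrite aE // Theta_layer //; apply: Theta_ker => // j' jj'.
by rewrite -aE ?(ltnW jj') // x0 // gtn_eqF.
Qed.

Lemma asym_single_supported_at j (M : 'M_(cell_rank (ac_cell j))) : supported_at j
  (asym_single M).
Proof. by move=> j' jj'; rewrite asym_single_out // -val_eqE eq_sym. Qed.

Lemma theta_above_asym_single_swich j M : theta_above j (asym_single (M *m swich X j)).
Proof. by have [b bE] := asym_single_swich M; exists b. Qed.

Lemma asym_sumE (I : finType) (g : I -> asym X) j : (\sum_l g l) j = \sum_l g l j.
Proof. by apply: (big_morph (fun x : asym X => x j)). Qed.

(** Idempotency writes the preimage of 1 under alpha as a sum of products y_p z_p in the layer, so 1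
    is the sum of alpha(y_p) psi alpha(z_p). The factors l_p and r_p are alpha(y_p) psi and
    alpha(z_p), placed in component [j]. *)
Lemma theta_above_excisive_unit j : idempotent_ideal (layer X j) ->
  exists N (l r : 'I_N -> asym X),
    [/\ forall p, supported_at j (l p), forall p, theta_above j (l p), forall p,
      supported_at j (r p) &
        forall x, supported_at j x -> \sum_p l p * (r p * x) = x].
Proof.
move=> idem; have := cell_isoVP (ac_cellP j) 1%:M.
rewrite -[X in X _]idem => -[N [y [z [Ly Lz yz]]]].
exists N, (fun p => asym_single (alpha j (y p) *m swich X j)),
  (fun p => asym_single (alpha j (z p))).
split=> [p|p|p|x x0]; try exact: asym_single_supported_at;
  first exact: theta_above_asym_single_swich.
(* Additivity of alpha is given on the layer only, so membership is carried along with the sum. *)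
have alphaS (g : 'I_N -> quot_alg (ac_ideal j)) : (forall p, layer X j (g p)) ->
    alpha j (\sum_p g p) = \sum_p alpha j (g p).
  move=> Lg; suff [] : layer X j (\sum_p g p) /\
    alpha j (\sum_p g p) = \sum_p alpha j (g p) by [].
  have HJ := cell_ideal2 (ac_cellP j).
  elim/big_rec2: _ => [|p u v _ [Lv IHv]].
    by split; [exact: (ideal2_0 HJ)|exact: alpha0].
  split; first by apply: (ideal2_D HJ) => //; exact: Lg.
  by rewrite (cell_isoD (ac_cellP j)) ?IHv //; exact: Lg.
apply: functional_extensionality_dep => j'; rewrite asym_sumE.
have [<-|jj'] := eqVneq j j'; last first.
  rewrite big1 ?x0 // 1?val_eqE 1?eq_sym // => p _.
  by rewrite -[LHS]/(_ *m _) asym_single_out // mul0mx.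
transitivity ((\sum_p alpha j (y p) *m swich X j *m alpha j (z p)) *m x j).
  rewrite mulmx_suml; apply: eq_bigr => p _.
  by rewrite -[LHS]/(asym_single _ j *m (asym_single _ j *m x j)) !asym_single_in mulmxA.
rewrite (_ : \sum_p _ = 1%:M) ?mul1mx // -(cell_isoVK (ac_cellP j) 1%:M) yz alphaS.
  apply: eq_bigr => p _.
  by rewrite -(cell_iso_form (ac_cellP j)) //; [exact: Ly|exact: Lz].
by move=> p; apply: (ideal2_Ml (cell_ideal2 (ac_cellP j))); exact: Lz.
Qed.

Lemma theta_above_left j x y : supported_at j x -> supported_at j y -> theta_above j y ->
  theta_above j (x * y).
Proof.
move=> x0 y0 yT; have [M yM] := theta_above_supported_at yT y0.
rewrite (_ : x * y = asym_single (x j *m M *m swich X j));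
  first exact: theta_above_asym_single_swich.
apply: functional_extensionality_dep => j'; rewrite -[LHS]/(x j' *m y j').
have [<-|jj'] := eqVneq j j'; first by rewrite asym_single_in yM mulmxA.
by rewrite asym_single_out // x0 ?mul0mx // val_eqE eq_sym.
Qed.

(** Among the components from [j] on, only the one at [j] can differ from [Theta X a], and this
    difference is split off. *)
Lemma theta_above_sum j x : theta_above j.+1 x ->
  exists y z, [/\ theta_above j y, supported_at j z & x = y + z].
Proof.
move=> [a aE]; exists (x - asym_single (x j - Theta X a j)),
  (asym_single (x j - Theta X a j)).
split; [|exact: asym_single_supported_at|by rewrite subrK].
exists a => j'; rewrite leq_eqVlt => /orP[/eqP/val_inj <-|jj'].
  by rewrite -[LHS]/(x j - asym_single _ j) asym_single_in opprB addrC subrK.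
rewrite -[LHS]/(x j' - asym_single _ j') asym_single_out ?subr0 ?aE //.
by rewrite -val_eqE /= ltn_eqF.
Qed.

End Layers.

(** * Application to Theta *)

Section ThetaHP.
Variables (F : fieldType) (K : comAlgType F) (k : comNzRingType) (A : algType k).
Variables (phi : central_hom K A) (i : A -> A) (X : affineCellular i).
Local Notation E := (scalar_alg (asym_base_hom phi X)).

Fact theta_above0 m : theta_above (X := X) m 0.
Proof. by exists 0 => j _; rewrite (raddf0 (Theta X)). Qed.

(** Scalars act through [Theta] of central elements of [A], so the witness can be rescaled inside
    [A]. *)
Fact theta_aboveP m (c : F) (x y : E) : theta_above m x -> theta_above m y ->
  theta_above m (c *: x + y : E).
Proof.
move=> [a aE] [b bE]; exists (phi (in_alg K c) * a + b) => j mj.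
have -> : Theta X (phi (in_alg K c) * a + b)
    = Theta X (phi (in_alg K c)) * Theta X a + Theta X b.
  by rewrite (raddfD (Theta X)); congr (_ + _); exact: (rmorphM (Theta X)).
by rewrite -[LHS]/(Theta X (phi (in_alg K c)) j *m x j + y j) aE // bE.
Qed.

Definition theta_above_submod m : submodule E :=
  Submodule (theta_above0 m) (@theta_aboveP m).

Fact supported_at0 m : supported_at (X := X) m 0. Proof. by []. Qed.

Fact supported_atP m (c : F) (x y : E) : supported_at m x -> supported_at m y ->
  supported_at m (c *: x + y : E).
Proof.
move=> x0 y0 j jm.
by rewrite -[LHS]/(Theta X (phi (in_alg K c)) j *m x j + y j) x0 // y0 // mulmx0 addr0.
Qed.

Definition supported_at_submod m : submodule E :=
  Submodule (@supported_at0 m) (@supported_atP m).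

Hypothesis det_swich : forall j, ~ zero_divisor (\det (swich X j)).
Hypothesis idempotent_layer : forall j, idempotent_ideal (layer X j).

Lemma theta_above_excisive m : (m < ac_len X)%N ->
  excisive (theta_above_submod m) (supported_at_submod m) (theta_above_submod m.+1).
Proof.
move=> mn; pose j := Ordinal mn; split.
- by move=> a x x0 j' jm; rewrite -[LHS]/(a j' *m x j') x0 // mulmx0.
- by move=> x a x0 j' jm; rewrite -[LHS]/(x j' *m a j') x0 // mul0mx.
- exact: (theta_above_left det_swich (j := j)).
- exact: theta_above_excisive_unit (idempotent_layer j).
- exact: (theta_above_sum (j := j)).
Qed.

Lemma Theta_HP_bijective m : bijective (HP_map (Theta_alg phi X) m).
Proof.
apply: (@HP_map_bijective_chain _ _ _ (Theta_alg phi X) _ (ac_len X) theta_above_submod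
  supported_at_submod).
- exact: (Theta_inj det_swich).
- move=> x; split=> [[a aE]|[a _ <-]]; last by exists a.
  by exists a => //; apply: functional_extensionality_dep => j; rewrite aE.
(* No component has index [ac_len X] or more, so any witness will do. *)
- by move=> x; exists 0 => j; rewrite leqNgt ltn_ord.
- move=> p x y [a aE] [b bE]; exists (a * b) => j pj.
  rewrite (_ : Theta X (a * b) = Theta X a * Theta X b); last exact: (rmorphM (Theta X)).
  by rewrite -[LHS]/(x j *m y j) aE // bE.
- by move=> p x [a aE]; exists a => j pj; apply: aE; exact: ltnW.
- exact: theta_above_excisive.
Qed.

End ThetaHP.
Theorem corollary21
  (k : idomainType) (k_noetherian : noetherian k)
  (A : algType k) (invol : A -> A) (X : affineCellular invol)
  (det_swich : forall j, ~ zero_divisor (\det (swich X j)))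
  (idempotent_layer : forall j, idempotent_ideal (layer X j))
  (R : realType) (K : comAlgType R[i]) (K_affine : affine_algebra K)
  (phi : central_hom K A) (A_finite : finite_module phi) (m : bool) :
  bijective (HP_map (Theta_alg phi X) m :
    {linear HP (scalar_alg (base_hom phi)) m ->
            HP (scalar_alg (asym_base_hom phi X)) m}).
Proof. exact: Theta_HP_bijective. Qed.
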